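(* Let $d\ge 2$ and let $\|\cdot\|_D$ be a $D$-norm on $\mathbb{R}^d$ which has partial derivatives of order $d$ on $(-\infty,0)^d$. Let $C$ be a copula on $\mathbb{R}^d$ which has continuous partial derivatives of order up to $d$ on $(0,1)^d$ and satisfies (i) $C(\boldsymbol{u}) = 1-\|\boldsymbol{1}-\boldsymbol{u}\|_D + o(\|\boldsymbol{1}-\boldsymbol{u}\|)$ as $\boldsymbol{u}\to\boldsymbol{1}$, uniformly for $\boldsymbol{u}\in[0,1]^d$; and (ii) for each nonempty set of distinct indices $\{i_1,\dots,i_k\}\subseteq\{1,\dots,d\}$ and all $\boldsymbol{x}<\boldsymbol{0}$ in $\mathbb{R}^d$, $$\frac{\partial^k}{\partial x_{i_1}\cdots\partial x_{i_k}}\, n\left(C\left(\boldsymbol{1}+\frac{\boldsymbol{x}}{n}\right)-1\right)\longrightarrow \frac{\partial^k}{\partial x_{i_1}\cdots\partial x_{i_k}}\bigl(-\|\boldsymbol{x}\|_D\bigr)\qquad (n\to\infty).$$ Let $C^{(n)}(\boldsymbol{u}):=C\left(u_1^{1/n},\dots,u_d^{1/n}\right)^n$, $\boldsymbol{u}\in[0,1]^d$, and let $C_G(\boldsymbol{u}):=\exp\left(-\|(\log u_1,\dots,\log u_d)\|_D\right)$, $\boldsymbol{u}\in[0,1]^d$. Then $$\sup_{A\in\mathbb{B}^d\cap[0,1]^d}\left|C^{(n)}(A)-C_G(A)\right|\longrightarrow 0\qquad (n\to\infty),$$ where $\mathbb{B}^d\cap[0,1]^d$ denotes the Borel subsets of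 $[0,1]^d$.
   Context: All operations and inequalities between vectors are componentwise; $\boldsymbol{0}=(0,\dots,0)$, $\boldsymbol{1}=(1,\dots,1)$. A norm $\|\cdot\|_D$ on $\mathbb{R}^d$ is a $D$-norm if there is a random vector $\boldsymbol{Z}=(Z_1,\dots,Z_d)$ with $Z_i\ge 0$ and $E(Z_i)=1$ for $1\le i\le d$ such that $\|\boldsymbol{x}\|_D=E\left(\max_{1\le i\le d}|x_i|Z_i\right)$ for all $\boldsymbol{x}\in\mathbb{R}^d$. A copula on $\mathbb{R}^d$ is the distribution function of a random vector whose components are each uniformly distributed on $[0,1]$. In (i), $\|\cdot\|$ is an arbitrary norm on $\mathbb{R}^d$. Both $C^{(n)}$ and $C_G$ are copulas ($C_G$ is the extreme-value copula associated with $\|\cdot\|_D$, taken to be $0$ when some $u_j=0$). The same letter denotes a probability measure and its distribution function. *)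

(* Defs.v *)
From HB Require Import structures.
From mathcomp Require Import all_boot all_order all_algebra.
From mathcomp Require Import all_classical all_reals all_analysis.
Import Order.TTheory GRing.Theory Num.Theory.
Import numFieldNormedType.Exports.

Set Implicit Arguments.
Unset Strict Implicit.
Unset Printing Implicit Defensive.

Local Open Scope classical_set_scope.
Local Open Scope ring_scope.

(* R^d with its Borel sigma-algebra, i.e., the one generated by the open sets.
   For matrices, [measurable] has no canonical instance in the library. *)
Notation borel_rV R d := (g_sigma_algebraType (@open 'rV[R]_d)).

Section Defs.
Variables (R : realType) (d : nat).
Implicit Types (C D N F : 'rV[R]_d -> R) (u x : 'rV[R]_d).

Definition closed_cube : set 'rV[R]_d := [set u | forall i, 0 <= u 0 i <= 1].
Definition open_cube : set 'rV[R]_d := [set u | forall i, 0 < u 0 i < 1].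
Definition neg_orthant : set 'rV[R]_d := [set x | forall i, x 0 i < 0].

Definition is_norm N : Prop :=
  [/\ forall x, N x = 0 -> x = 0,
      forall (a : R) x, N (a *: x) = `|a| * N x &
      forall x y, N (x + y) <= N x + N y].

(* The maximum is taken with default value 0, which is harmless since the
   terms |x_i| Z_i are nonnegative. *)
Definition is_Dnorm D : Prop :=
  is_norm D /\
  exists (disp : measure_display) (T : measurableType disp)
         (P : probability T R) (Z : {RV P >-> borel_rV R d}),
    [/\ forall w i, 0 <= (Z w : 'rV[R]_d) 0 i,
        forall i, 'E_P[fun w => ((Z w : 'rV[R]_d) 0 i)%R]%E = 1%E &
        forall x, (D x)%:E =
          'E_P[fun w => (\big[Num.max/0]_(i < d)
                           (`|x 0 i| * (Z w : 'rV[R]_d) 0 i))%R]%E].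

Definition df (Q : set (borel_rV R d) -> \bar R) u : R :=
  fine (Q [set v : 'rV[R]_d | forall i, v 0 i <= u 0 i]).

Definition is_copula C : Prop :=
  exists (disp : measure_display) (T : measurableType disp)
         (P : probability T R) (U : {RV P >-> borel_rV R d}),
    (forall i (A : set (measurableTypeR R)), measurable A ->
       P [set w | A ((U w : 'rV[R]_d) 0 i)] = uniform_prob (@ltr01 R) A) /\
    (forall u, C u = df (distribution P U) u).

(* partial [:: i1; ...; ik] f is the iterated partial derivative
   d/dx_i1 (d/dx_i2 (... (d/dx_ik f))), the indices being possibly repeated. *)
Definition partial (s : seq 'I_d) F : 'rV[R]_d -> R :=
  foldr (fun i G x => 'D_(delta_mx 0 i) G x) F s.

(* All partial derivatives of order at most k exist at every point of A (an
   open set): 'D is a total operator, so each one-variable differentiation has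
   to be asserted to be legitimate. *)
Definition has_partials (k : nat) (A : set 'rV[R]_d) F : Prop :=
  forall (s : seq 'I_d) (i : 'I_d) x, (size s < k)%N -> A x ->
    derivable (partial s F) x (delta_mx 0 i).

Definition has_continuous_partials (k : nat) (A : set 'rV[R]_d) F : Prop :=
  has_partials k A F /\
  forall (s : seq 'I_d) x, (size s <= k)%N -> A x ->
    {for x, continuous (partial s F)}.

(* C^(n), for n > 0 *)
Definition copula_power C (n : nat) u : R :=
  C (\row_i (u 0 i `^ n%:R^-1)) ^+ n.

(* C_G; the library's ln is 0 at 0, hence the case distinction *)
Definition evc D u : R :=
  if [exists i, u 0 i == 0] then 0 else expR (- D (\row_i ln (u 0 i))).

End Defs.

Arguments closed_cube {R d}.
Arguments open_cube {R d}.
Arguments neg_orthant {R d}.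

(* Main.v *)
(** In the coordinates [x = log u] the limit law has distribution function
    exp(-D x) on the negative orthant, and with [T_n x = n (exp(x/n) - 1)] the
    law of the n-th power copula becomes a law [mu_n] with distribution function
    C(1 + x/n)^n.  Hypotheses (i) and (ii) give pointwise convergence of all the
    mixed derivatives, hence of the densities of [mu_n] to that of the limit
    [mu], and Scheffé's argument yields convergence in total variation.

    The density of [mu] need not be continuous; but a box measure is obtained by
    successive one-variable integrations, and a monotone function that is
    differentiable everywhere is the integral of its derivative, so the mere
    existence of the partial derivatives of [D] is enough.

    Going back from [mu_n] amounts to transporting it by the inverse [S_n] of
    [T_n].  As [mu_n] and [mu_k] are close for fixed large [k], so are
    their images under [S_n]; and the image of [mu_k] under [S_n] tends to [mu_k]
    as n grows, by Scheffé's argument again, now using the continuity of the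
    partial derivatives of [C]. *)

(* The detour through [S_n] comes from the form of (ii). On the scale of x = log u the density of
   C^(n) involves derivatives of C at exp(x/n) = 1 + T_n x / n, so (ii) would be needed at the
   moving point T_n x, whereas it gives convergence at each fixed x only, without local uniformity.
   Transport by one and the same map cannot increase total variation distance, so the moving point
   can be handed over to mu_k with k fixed, where continuity of the partial derivatives of C takes
   care of it. Scheffé's argument is run one-sidedly: the positive part of the limit density minus
   the n-th density is dominated by the limit density, and only the limit law has to put almost all
   its mass on a bounded cube. Complements give the reverse inequality. All densities must refer to
   one reference measure; it is assembled from one-dimensional integrals, one coordinate at a time,
   just as box measures are recovered. Iterated differences of a distribution function are
   nonnegative; this makes the mixed derivatives nonnegative and every one-variable function to be
   integrated monotone. *)
Require Import Defs.
From HB Require Import structures.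
From mathcomp Require Import all_boot all_order all_algebra.
From mathcomp Require Import all_classical all_reals all_analysis.
From mathcomp Require Import measurable_realfun ring lra.
Import Order.TTheory GRing.Theory Num.Theory.
Import numFieldNormedType.Exports.
Local Open Scope classical_set_scope.
Local Open Scope ring_scope.

Set Implicit Arguments.
Unset Strict Implicit.
Unset Printing Implicit Defensive.

(** * Differentiation of Lebesgue-Stieltjes measures *)

Section stieltjes_growth.
Variable R : realType.
Implicit Types (f g : cumulative R R) (E F : set R).
Local Notation mu := (@lebesgue_stieltjes_measure R).

Lemma lebesgue_stieltjes_itvoc f (a b : R) : a <= b ->
  mu f `]a, b]%classic = (f b - f a)%:E.
Proof.
move=> ab; rewrite /lebesgue_stieltjes_measure /measure_extension/=.
by rewrite measurable_mu_extE/= ?wlength_itv_bnd//; exact: is_ocitv.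
Qed.

(** By continuity the bound [M] passes to the increment of [f] from [inf F] to [sup F]. A half-open
    interval containing [F] may have to start strictly left of [inf F], which costs an arbitrarily
    small increment, again by continuity. *)
Lemma lebesgue_stieltjes_osc f F (a b M : R) : continuous f ->
  measurable (F : set (measurableTypeR R)) -> F `<=` `]a, b] -> 0 <= M ->
  (forall x y, F x -> F y -> x <= y -> f y - f x <= M) ->
  (mu f F <= M%:E)%E.
Proof.
move=> cf mF Fab M0 FM.
have [->|/set0P[z Fz]] := eqVneq F set0; first by rewrite measure0 lee_fin.
have fnd := cumulative_is_nondecreasing f.
have hs : has_sup F.
  by split; [exists z | exists b => y /Fab/=; rewrite in_itv/= => /andP[]].
have hi : has_inf F.
  by split; [exists z | exists a => y /Fab/=; rewrite in_itv/= => /andP[/ltW]].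
have infF x : F x -> inf F <= x by move=> Fx; apply: ge_inf => //; case: hi.
have supF x : F x -> x <= sup F by move=> Fx; apply: ub_le_sup => //; case: hs.
have is_ : inf F <= sup F by rewrite (le_trans (infF _ Fz)) ?supF.
have osc : f (sup F) - f (inf F) <= M.
  rewrite leNgt; apply/negP => lt.
  set e := (f (sup F) - f (inf F) - M) / 2.
  have e0 : 0 < e by rewrite divr_gt0// subr_gt0.
  have /cvgrPdist_lt/(_ _ e0) := cf (sup F); move=> /nbhs_ballP[d1/= d10 B1].
  have /cvgrPdist_lt/(_ _ e0) := cf (inf F); move=> /nbhs_ballP[d2/= d20 B2].
  have [y Fy yd] := sup_adherent d10 hs.
  have [x Fx xd] := inf_adherent d20 hi.
  have := B1 y; rewrite /ball/= ger0_norm ?subr_ge0 ?supF// => /(_ ltac:(lra)).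
  have := B2 x; rewrite /ball/= ler0_norm ?subr_le0 ?infF// => /(_ ltac:(lra)).
  rewrite !ltr_norml => /andP[h1 _] /andP[_ h2].
  have h : M < f y - f x by rewrite /e in h1 h2; lra.
  have [xy|/ltW yx] := leP x y; first by have := FM _ _ Fx Fy xy; lra.
  by have := fnd _ _ yx; lra.
apply/lee_addgt0Pr => e e0.
have /cvgrPdist_lt/(_ _ e0) := cf (inf F); move=> /nbhs_ballP[d/= d0 B].
have : `|f (inf F) - f (inf F - d / 2)| < e.
  by apply: B; rewrite /ball/= opprB addrCA subrr addr0 gtr0_norm; lra.
rewrite ltr_norml => /andP[_ fd].
apply: (@le_trans _ _ (mu f `]inf F - d / 2, sup F]%classic)).
  apply: le_measure; rewrite ?inE//.
  by move=> x Fx /=; rewrite in_itv/= supF// andbT; have := infF _ Fx; lra.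
by rewrite lebesgue_stieltjes_itvoc -?EFinD ?lee_fin; lra.
Qed.

(* A cover of [E] by half-open intervals that is almost optimal for [mu g] also
   bounds [mu f E]. *)
Lemma lebesgue_stieltjes_le_pairs f g E (c a b : R) : continuous f -> 0 <= c ->
  measurable (E : set (measurableTypeR R)) -> E `<=` `]a, b] ->
  (forall x y, E x -> E y -> x <= y -> f y - f x <= c * (g y - g x)) ->
  (mu f E <= c%:E * mu g E)%E.
Proof.
move=> cf c0 mE Eab fg.
have gnd := cumulative_is_nondecreasing g.
have gE : mu g E \is a fin_num.
  rewrite ge0_fin_numE//; have [ab|ba] := leP a b.
    apply: (@le_lt_trans _ _ (mu g `]a, b]%classic)).
      by apply: le_measure; rewrite ?inE.
    by rewrite lebesgue_stieltjes_itvoc// ltry.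
  rewrite (_ : E = set0) ?measure0// -subset0 => x /Eab/=.
  by rewrite in_itv/= => /andP[]; lra.
apply/lee_addgt0Pr => e e0.
(* Dividing by [c + 1] gives [c * e' <= e] also when [c] is 0. *)
set e' := e / (c + 1).
have e'0 : 0 < e' by rewrite divr_gt0// addrC ltr_wpDr.
have [_/= [A [mA EA] <-] Ae] := lb_ereal_inf_adherent e'0 gE.
have mA' k : measurable (A k : set (measurableTypeR R)).
  by apply: sub_sigma_algebra; exact: mA.
apply: (@le_trans _ _ (\sum_(0 <= k <oo) mu f (E `&` A k))%E).
  rewrite [leLHS](_ : _ = mu f (\bigcup_k (E `&` A k))); last first.
    congr (mu f _); rewrite -setI_bigcupr; apply/esym/setIidPl; exact: EA.
  apply: measure_sigma_subadditive => // [k|]; first exact: measurableI.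
  by apply: bigcupT_measurable => k; exact: measurableI.
(* On the part of [E] inside one covering interval, the pairwise hypothesis bounds the oscillation
   of [f] by [c] times the [g]-length of that interval. *)
apply: (@le_trans _ _ (\sum_(0 <= k <oo) (c%:E * wlength g (A k)))%E).
  apply: lee_nneseries => // k _.
  have [[u v] _ /= uvA] := mA k.
  have [uv|vu] := leP u v; last first.
    rewrite -uvA set_itv_ge ?setI0 ?measure0 ?wlength0 ?mule0//.
    by rewrite bnd_simp -leNgt ltW.
  rewrite -uvA wlength_itv_bnd// -EFinM.
  apply: (@lebesgue_stieltjes_osc _ _ u v) => //.
  - by rewrite uvA; exact: measurableI.
  - by rewrite mulr_ge0// subr_ge0 gnd.
  - move=> x y [Ex] /= xuv [Ey] /= yuv xy.
    rewrite (le_trans (fg _ _ Ex Ey xy))// ler_wpM2l//.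
    move: xuv yuv; rewrite !in_itv/= => /andP[/ltW ux _] /andP[_ yv].
    by rewrite lerB ?gnd.
rewrite nneseriesZl//.
apply: (@le_trans _ _ (c%:E * (mu g E + e'%:E))%E).
  by rewrite lee_wpmul2l// ltW.
rewrite muleDr ?fin_num_adde_defl// leeD2l// -EFinM lee_fin.
by rewrite /e' mulrCA ler_piMr ?ltW// ?ltr_pdivrMr; lra.
Qed.


(* The points where the inequality holds up to distance 1/(n+1) form a measurable
   set [E `&` S n]; cut into pieces of length 1/(n+2), it satisfies the pairwise
   inequality on each piece. *)
Lemma lebesgue_stieltjes_le_local f g E (c a b : R) :
  continuous f -> continuous g -> 0 <= c ->
  measurable (E : set (measurableTypeR R)) -> E `<=` `]a, b] ->
  (forall x, E x -> exists2 d, 0 < d &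
    forall y : R, x < y < x + d -> f y - f x <= c * (g y - g x)) ->
  (mu f E <= c%:E * mu g E)%E.
Proof.
move=> cf cg c0 mE Eab fg.
(* [O n y] holds the points for which [y] is a counterexample within distance 1/(n+1). It is open
   because [f] and [g] are continuous, so even the uncountable union over [y] is measurable. *)
pose O n (y : R) := [set x : R | x < y /\ y < x + n.+1%:R^-1 /\ c * (g y - g x) < f y - f x].
pose S n := ~` \bigcup_y O n y.
have oO n y : open (O n y).
  rewrite (_ : O n y = [set x | x < y] `&` ([set x | y - n.+1%:R^-1 < x] `&`
      [set x | 0 < (f y - f x) - c * (g y - g x)])).
    apply: openI; first exact: open_lt.
    apply: openI; first exact: open_gt.
    apply: (@open_comp _ _ (fun x => (f y - f x) - c * (g y - g x))
              [set z | 0 < z]); last exact: open_gt.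
    move=> x _; apply: cvgB.
      by apply: cvgB; [exact: cvg_cst|exact: cf].
    by apply: cvgMr; apply: cvgB; [exact: cvg_cst|exact: cg].
  rewrite /O; apply/seteqP; split=> [x [h1 [h2 h3]]|x [h1 [h2 h3]]].
    by split => //; split; rewrite /= ?subr_gt0 ?ltrBlDr.
  by split => //; split; [rewrite -ltrBlDr|rewrite -subr_gt0].
have mS n : measurable (S n : set (measurableTypeR R)).
  by apply: measurableC; apply: open_measurable; apply: bigcup_open.
have mES n : measurable (E `&` S n : set (measurableTypeR R)).
  exact: measurableI.
have ES : E = \bigcup_n (E `&` S n).
  apply/seteqP; split=> [x Ex|x [n _ []//]].
  have [d d0 dP] := fg _ Ex.
  have [n nd] : exists n, n.+1%:R^-1 < d.
    have [n _ h] := near_infty_natSinv_lt (PosNum d0).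
    by exists n; exact: (h n (leqnn n)).
  exists n => //; split => // -[y _ [xy [yx]]].
  by rewrite ltNge dP// xy/= (lt_trans yx)// ltrD2l.
have ndS : nondecreasing_seq (fun n => E `&` S n).
  move=> m n mn; apply/subsetPset => x [Ex Sx]; split => // -[y _ [xy [yx h]]].
  apply: Sx; exists y => //; split => //; split => //; rewrite (lt_le_trans yx)//.
  by rewrite lerD2l lef_pV2 ?posrE ?ler_nat.
have step n : (mu f (E `&` S n) <= c%:E * mu g (E `&` S n))%E.
  pose h : R := n.+2%:R^-1.
  have h0 : 0 < h by rewrite invr_gt0.
  pose I (j : nat) := `]a + j%:R * h, a + j.+1%:R * h]%classic.
  have mI j : measurable (I j : set (measurableTypeR R)) by exact: measurable_itv.
  pose P j := E `&` S n `&` I j.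
  have mP j : measurable (P j : set (measurableTypeR R)) by exact: measurableI.
  have UP : E `&` S n = \bigcup_j P j.
    apply/seteqP; split=> [x [Ex Sx]|x [j _ []//]].
    have /andP[ax _] : a < x <= b by have := Eab _ Ex; rewrite /= in_itv.
    have nx : exists k : nat, x <= a + k.+1%:R * h.
      exists (Num.truncn ((x - a) / h)).
      by rewrite -lerBlDl -ler_pdivrMr// ltW// truncnS_gt.
    case: (ex_minnP nx) => k kx kmin.
    exists k => //; split => //; rewrite /I/= in_itv/= kx andbT.
    case: k kmin {kx} => [|k] kmin; first by rewrite mul0r addr0.
    by rewrite ltNge; apply/negP => /kmin; rewrite ltnn.
  have tP : trivIset setT P.
    apply: trivIset_setIl; apply/trivIsetP => i j _ _.
    wlog: i j / (i < j)%N.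
      move=> w ij; case: (ltngtP i j) => [lt|gt|e]; first exact: w.
        by rewrite setIC; apply: w => //; rewrite eq_sym.
      by rewrite e eqxx in ij.
    move=> ij _; rewrite -subset0 => x []; rewrite /I /= !in_itv/=.
    move=> /andP[_ h1] /andP[h2 _]; have : i.+1%:R * h <= j%:R * h.
      by rewrite ler_pM2r// ler_nat.
    by lra.
  rewrite UP !measure_bigcup//=.
  rewrite -nneseriesZl//; apply: lee_nneseries => // j _.
  apply: (@lebesgue_stieltjes_le_pairs _ _ _ _ (a + j%:R * h) (a + j.+1%:R * h)) => //.
    by move=> x [].
  move=> x y [[Ex Sx] Ix] [_ Iy]; rewrite le_eqVlt => /predU1P[->|xy].
    by rewrite !subrr mulr0.
  rewrite leNgt; apply/negP => lt; apply: Sx; exists y => //; split => //; split => //.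
  move: Ix Iy; rewrite /I/= !in_itv/= => /andP[h1 _] /andP[_ h2].
  have : h < n.+1%:R^-1 by rewrite ltf_pV2 ?posrE// ltr_nat.
  move=> hn; apply: (@lt_trans _ _ (x + h)); last by rewrite ltrD2l.
  move: h1 h2; rewrite -[j.+1%:R]natr1 mulrDl mul1r addrA.
  by move: (a + _) => z zx yz; rewrite (le_lt_trans yz)// ltrD2r.
have cvf := nondecreasing_cvg_mu (mu := mu f) mES (bigcupT_measurable _ mES) ndS.
have cvg' := nondecreasing_cvg_mu (mu := mu g) mES (bigcupT_measurable _ mES) ndS.
rewrite -ES in cvf cvg'.
apply: (@le_trans _ _ (ereal_sup (range (mu f \o (fun n => E `&` S n))))).
  rewrite -(cvg_lim _ cvf)//; apply: lime_le; first by apply/cvg_ex; eexists; exact: cvf.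
  by apply: nearW => n; apply: ereal_sup_ubound; exists n.
apply: ge_ereal_sup => _ [n _ <-] /=; rewrite (le_trans (step n))//.
by rewrite lee_wpmul2l// le_measure ?inE.
Qed.

End stieltjes_growth.

(** * Integrals of derivatives of monotone functions *)

Section stieltjes_derive.
Variable R : realType.
Implicit Types (f g : cumulative R R) (E F : set R).
Local Notation mu := (@lebesgue_stieltjes_measure R).
Local Notation lambda := (@lebesgue_measure R).

(** A countable family of difference quotients suffices to reach the derivative; this is how
    derivatives are shown to be measurable and nonnegative. *)
Lemma derive_seq (V : normedModType R) (h : V -> R) (x v : V) : derivable h x v ->
  (fun n : nat => n.+1%:R * (h (x + n.+1%:R^-1 *: v) - h x)) @ \oo --> 'D_v h x.
Proof.
move=> /cvgr_dnbhsP dh.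
have /dh : (forall n, n.+1%:R^-1 != 0 :> R) /\ (fun n => n.+1%:R^-1 : R) @ \oo --> 0.
  by split=> //; exact: cvg_harmonic.
apply: cvg_trans; apply: near_eq_cvg; apply: nearW => n /=.
by rewrite invrK [_ *: v + x]addrC.
Qed.

Lemma derive_local_nondecreasing_ge0 (phi : R -> R) (a b t : R) : a < t < b ->
  (forall s u, a < s -> s <= u -> u < b -> phi s <= phi u) ->
  derivable phi t 1 -> 0 <= 'D_1 phi t.
Proof.
move=> /andP[at_ tb] nd dphi.
have h := derive_seq dphi; rewrite -(cvg_lim _ h)//.
apply: limr_ge; first by apply/cvg_ex; eexists; exact: h.
have bt0 : 0 < b - t by rewrite subr_gt0.
near=> n; rewrite mulr_ge0// subr_ge0 nd//.
  by rewrite lerDl /GRing.scale/= mulr1 invr_ge0.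
rewrite -ltrBrDl /GRing.scale/= mulr1.
by near: n; exact: near_infty_natSinv_lt (PosNum bt0).
Unshelve. all: by end_near. Qed.

Lemma derive1_right_le (f : R -> R) (x c : R) : derivable f x 1 -> 'D_1 f x < c ->
  exists2 d, 0 < d & forall y : R, x < y < x + d -> f y - f x <= c * (y - x).
Proof.
move=> df fc.
have /cvgrPdist_lt/(_ (c - 'D_1 f x)) := df; rewrite subr_gt0 => /(_ fc).
rewrite near_withinE => -[d/= d0 B]; exists d => // y /andP[xy yxd].
have := B (y - x); rewrite /ball_/= sub0r normrN gtr0_norm ?subr_gt0//.
rewrite ltrBlDl => /(_ yxd); rewrite subr_eq0 gt_eqF// => /(_ isT).
rewrite scaler1 subrK /derive.
rewrite distrC => /(le_lt_trans (ler_norm _)); rewrite ltrBlDr subrK /GRing.scale/=.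
by rewrite mulrC ltr_pdivrMr ?subr_gt0// => /ltW.
Qed.

Lemma derive1_right_ge (f : R -> R) (x c : R) : derivable f x 1 -> c < 'D_1 f x ->
  exists2 d, 0 < d & forall y : R, x < y < x + d -> c * (y - x) <= f y - f x.
Proof.
move=> df fc.
have /cvgrPdist_lt/(_ ('D_1 f x - c)) := df; rewrite subr_gt0 => /(_ fc).
rewrite near_withinE => -[d/= d0 B]; exists d => // y /andP[xy yxd].
have := B (y - x); rewrite /ball_/= sub0r normrN gtr0_norm ?subr_gt0//.
rewrite ltrBlDl => /(_ yxd); rewrite subr_eq0 gt_eqF// => /(_ isT).
rewrite scaler1 subrK /derive.
move=> /(le_lt_trans (ler_norm _)); rewrite ltrD2l ltrN2 /GRing.scale/=.
by rewrite mulrC ltr_pdivlMr ?subr_gt0// => /ltW.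
Qed.

(** Comparison with the identity, whose Stieltjes measure is Lebesgue measure. The strict bound on
    the derivative yields the local growth condition to the right of each point. *)
Lemma lebesgue_stieltjes_derive_le f E (c a b : R) : continuous f -> 0 <= c ->
  measurable (E : set (measurableTypeR R)) -> E `<=` `]a, b] ->
  (forall x, E x -> derivable f x 1 /\ 'D_1 f x < c) ->
  (mu f E <= c%:E * lambda E)%E.
Proof.
move=> cf c0 mE Eab Ec.
apply: (@lebesgue_stieltjes_le_local _ f idfun E c a b) => //.
  by move=> x; exact: cvg_id.
by move=> x /Ec[df fc]; exact: derive1_right_le.
Qed.

(** The same comparison with the roles of [f] and the identity exchanged and constant [c^-1], whence
    [c] positive. *)
Lemma lebesgue_stieltjes_derive_ge f E (c a b : R) : continuous f -> 0 < c ->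
  measurable (E : set (measurableTypeR R)) -> E `<=` `]a, b] ->
  (forall x, E x -> derivable f x 1 /\ c < 'D_1 f x) ->
  (c%:E * lambda E <= mu f E)%E.
Proof.
move=> cf c0 mE Eab Ec.
rewrite -lee_pdivlMl//.
apply: (@lebesgue_stieltjes_le_local _ idfun f E c^-1 a b) => //.
  by move=> x; exact: cvg_id.
  by rewrite invr_ge0 ltW.
move=> x /Ec[df fc]; have [d d0 h] := derive1_right_ge df fc.
by exists d => // y xy; rewrite ler_pdivlMl// h.
Qed.

Lemma measurable_fun_derive1 f (D : set R) :
  measurable (D : set (measurableTypeR R)) ->
  (forall x, D x -> derivable f x 1) -> measurable_fun D (fun x : R => 'D_1 f x).
Proof.
move=> mD df.
have mf D' : measurable D' -> measurable_fun D' f.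
  move=> mD'; apply: nondecreasing_measurable => //.
  by move=> x y xy; exact: (cumulative_is_nondecreasing f).
apply: (@measurable_fun_cvg _ R R D
  (fun n (x : R) => n.+1%:R * (f (x + n.+1%:R^-1 *: (1 : R)) - f x))).
  move=> n; apply: measurable_funM => //; apply: measurable_funB; last exact: mf.
  apply: (measurableT_comp (f := f)); first exact: mf.
  by apply: measurable_funD.
by move=> x Dx; exact: derive_seq (df _ Dx).
Qed.

(* On the set [A k] where the derivative is in [k e, (k+1) e[, both [mu f] and the
   integral of the derivative are (k e) lambda up to 2 e lambda. *)
Lemma integral_derive_stieltjes f (p q : R) : p <= q -> continuous f ->
  (forall x, p < x < q -> derivable f x 1) ->
  (\int[lambda]_(x in `]p, q[) ('D_1 f x)%:E = (f q - f p)%:E)%E.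
Proof.
move=> pq cf df.
have fnd := cumulative_is_nondecreasing f.
pose I : set R := `]p, q[%classic.
have mI : measurable (I : set (measurableTypeR R)) by exact: measurable_itv.
have dfI x : I x -> derivable f x 1 by rewrite /I/= in_itv; exact: df.
have df0 x : I x -> 0 <= 'D_1 f x.
  move=> Ix; apply: (@derive_local_nondecreasing_ge0 _ (x - 1) (x + 1)).
  - by rewrite ltrBlDr !ltrDl ltr01.
  - by move=> s u _ su _; exact: fnd.
  - exact: dfI.
have mdf := measurable_fun_derive1 mI dfI.
have mI_fin : (lambda I < +oo)%E.
  by rewrite lebesgue_measure_itv/=; case: ifP => // _; rewrite -EFinB ltry.
have muI : mu f I = (f q - f p)%:E.
  apply/eqP; rewrite -lebesgue_stieltjes_itvoc// eq_le; apply/andP; split.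
    apply: le_measure; rewrite ?inE//.
    by apply: subset_itvl; rewrite bnd_simp.
  (* Continuity of [f] makes the endpoint [q] a null set, so the open and the half-open interval
     have the same measure. *)
  have q0 : mu f [set q] = 0%E.
    apply/eqP; rewrite -measure_le0.
    apply: (@lebesgue_stieltjes_osc _ _ _ (q - 1) q) => //.
      by move=> x ->; rewrite /= in_itv/= lexx andbT; lra.
    by move=> x y -> ->; rewrite subrr.
  apply: (@le_trans _ _ (mu f (I `|` [set q]))).
    apply: le_measure; rewrite ?inE//; first exact: measurableU.
    move=> x /=; rewrite in_itv/= => /andP[px].
    rewrite le_eqVlt => /predU1P[->|xq]; first by right.
    by left; rewrite /I/= in_itv/= px.
  rewrite -[leRHS]adde0 -q0; exact: measureU2.
rewrite -/I -muI.
have key (e : R) : 0 < e ->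
    (\int[lambda]_(x in I) ('D_1 f x)%:E <= mu f I + (2 * e)%:E * lambda I)%E /\
    (mu f I <= \int[lambda]_(x in I) ('D_1 f x)%:E + e%:E * lambda I)%E.
  move=> e0.
  pose A (k : nat) := I `&` (fun x => 'D_1 f x) @^-1` `[k%:R * e, k.+1%:R * e[.
  have mA k : measurable (A k : set (measurableTypeR R)).
    by apply: mdf => //; exact: measurable_itv.
  have UA : I = \bigcup_k A k.
    apply/seteqP; split=> [x Ix|x [k _ []//]].
    exists (Num.truncn ('D_1 f x / e)) => //; split => //=; rewrite in_itv/=.
    rewrite -ler_pdivlMr// -ltr_pdivrMr// truncnS_gt andbT.
    by rewrite truncn_le divr_ge0 ?df0// ltW.
  have tA : trivIset setT A.
    have At k x : A k x -> Num.truncn ('D_1 f x / e) = k.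
      move=> [_]; rewrite /= in_itv/= => h; apply: truncn_def.
      by rewrite ler_pdivlMr// ltr_pdivrMr.
    by move=> i j _ _ [x [/At <- /At <-]].
  have AI k : A k `<=` I by move=> x [].
  have Aoc k : A k `<=` `]p, q].
    by move=> x /AI; apply: subset_itvl; rewrite bnd_simp.
  have Afin k : lambda (A k) \is a fin_num.
    rewrite ge0_fin_numE// (le_lt_trans _ mI_fin)//.
    by apply: le_measure; rewrite ?inE.
  have dfA k x : A k x -> k%:R * e <= 'D_1 f x < k.+1%:R * e.
    by move=> [_]; rewrite /= in_itv.
  have intle k : (\int[lambda]_(x in A k) ('D_1 f x)%:E <= (k.+1%:R * e)%:E * lambda (A k))%E.
    rewrite -integral_cst//; apply: ge0_le_integral => //.
    - by move=> x [/df0]; rewrite lee_fin.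
    - by apply/measurable_EFinP; apply: measurable_funS mdf.
    - by move=> x Ax; rewrite lee_fin ltW//; have /andP[] := dfA _ _ Ax.
  have intge k : ((k%:R * e)%:E * lambda (A k) <= \int[lambda]_(x in A k) ('D_1 f x)%:E)%E.
    rewrite -integral_cst//; apply: ge0_le_integral => //.
    - by move=> x _; rewrite lee_fin mulr_ge0// ltW.
    - by apply/measurable_EFinP; apply: measurable_funS mdf.
    - by move=> x Ax; rewrite lee_fin; have /andP[] := dfA _ _ Ax.
  have mule k : (mu f (A k) <= (k.+1%:R * e)%:E * lambda (A k))%E.
    apply: (@lebesgue_stieltjes_derive_le _ _ _ p q) => //.
      by rewrite mulr_ge0// ltW.
    move=> x Ax; split; first by apply: dfI; exact: (AI k).
    by have /andP[] := dfA _ _ Ax.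
  (* The lower comparison needs a strict bound, but on [A k] the derivative may equal [k e]; one
     layer is given up, hence the total error [2 * e]. For [k] equal to 0 or 1 the left side is not
     positive. *)
  have muge k : (((k%:R - 1) * e)%:E * lambda (A k) <= mu f (A k))%E.
    case: k => [|k].
      apply: (@le_trans _ _ 0%E) => //.
      by rewrite mule_le0_ge0// lee_fin; nra.
    case: k => [|k]; first by rewrite subrr mul0r mul0e.
    apply: (@lebesgue_stieltjes_derive_ge _ _ _ p q) => //.
      by rewrite mulr_gt0// subr_gt0 ltr1n.
    move=> x Ax; split; first by apply: dfI; exact: (AI k.+2).
    have /andP[h _] := dfA _ _ Ax; apply: lt_le_trans h.
    by rewrite ltr_pM2r// gtrBl.
  have muU (m : {measure set (measurableTypeR R) -> \bar R}) :
      (m I = \sum_(0 <= k <oo) m (A k))%E.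
    rewrite UA measure_bigcup//=.
    by apply: eq_eseriesl => k; rewrite in_setT.
  have intA k : (0 <= \int[lambda]_(x in A k) ('D_1 f x)%:E)%E.
    by apply: integral_ge0 => x [/df0]; rewrite lee_fin.
  have -> : (\int[lambda]_(x in I) ('D_1 f x)%:E =
             \sum_(0 <= k <oo) \int[lambda]_(x in A k) ('D_1 f x)%:E)%E.
    rewrite {1}UA ge0_integral_bigcup// -UA.
      by apply/measurable_EFinP.
    by move=> x /df0; rewrite lee_fin.
  have e20 : 0 <= 2 * e by rewrite mulr_ge0// ltW.
  split; rewrite !muU -nneseriesZl// -nneseriesD//; last first.
  - by move=> k _ _; rewrite mule_ge0// lee_fin ltW.
  - apply: lee_nneseries => // k _.
    apply: (le_trans (mule k)).
    apply: (@le_trans _ _ ((k%:R * e)%:E * lambda (A k) + e%:E * lambda (A k))%E); last first.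
      exact: leeD2r.
    rewrite -(fineK (Afin k)) -!EFinM -EFinD lee_fin -mulrDl ler_wpM2r ?fine_ge0//.
    by rewrite -natr1; lra.
  - by move=> k _ _; rewrite mule_ge0// lee_fin ltW.
  apply: lee_nneseries => // k _.
  apply: (le_trans (intle k)).
  apply: (@le_trans _ _ (((k%:R - 1) * e)%:E * lambda (A k) + (2 * e)%:E * lambda (A k))%E); last first.
    exact: leeD2r.
  rewrite -(fineK (Afin k)) -!EFinM -EFinD lee_fin -mulrDl ler_wpM2r ?fine_ge0//.
  by rewrite -natr1; lra.
have lI : lambda I = (q - p)%:E.
  rewrite lebesgue_measure_itv/= lte_fin; case: ltP => // qp.
  by rewrite (_ : q = p) ?subrr//; lra.
apply/eqP; rewrite eq_le; apply/andP; split; apply/lee_addgt0Pr => e e0.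
  (* The length [q - p] may be 0; adding 1 keeps the divisor positive, and the 2 absorbs the error
     [2 * e] of [key]. *)
  have d0 : 0 < 2 * (q - p + 1) by lra.
  have [|+ _] := key (e / (2 * (q - p + 1))); first exact: divr_gt0.
  move=> /le_trans; apply; rewrite leeD2l// lI -EFinM lee_fin.
  by rewrite mulrA mulrAC ler_pdivrMr// mulrAC mulrC ler_pM2l//; lra.
have d0 : 0 < q - p + 1 by lra.
have [|_ +] := key (e / (q - p + 1)); first exact: divr_gt0.
move=> /le_trans; apply; rewrite leeD2l// lI -EFinM lee_fin.
by rewrite mulrAC ler_pdivrMr// ler_pM2l//; lra.
Qed.

(** Freezing [phi] outside [[p, q]] gives a continuous nondecreasing function on the whole line,
    hence a [cumulative]. It agrees with [phi] near every interior point, and the endpoint [q] does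
    not affect the Lebesgue integral. *)
Lemma integral_derive_nondecreasing (phi : R -> R) (l u p q : R) :
  l < p -> p <= q -> q < u ->
  (forall x y, l < x -> x <= y -> y < u -> phi x <= phi y) ->
  (forall x, l < x < u -> derivable phi x 1) ->
  (\int[lambda]_(x in `]p, q]) ('D_1 phi x)%:E = (phi q - phi p)%:E)%E.
Proof.
move=> lp pq qu nd dphi.
pose clamp (x : R) := Num.max p (Num.min x q).
have clampP x : p <= clamp x <= q.
  by rewrite /clamp le_max lexx ge_max pq ge_min lexx orbT.
have clampE x : p <= x <= q -> clamp x = x.
  by move=> /andP[px xq]; rewrite /clamp (min_idPl xq) (max_idPr px).
pose F x := phi (clamp x).
have ndF : nondecreasing F.
  move=> x y xy; have /andP[h1 h2] := clampP x; have /andP[h3 h4] := clampP y.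
  apply: nd; [lra| |lra].
  by rewrite /clamp ge_max le_max lexx/= le_max le_min !ge_min xy lexx !orbT.
have cF : continuous F.
  move=> x; apply: (@continuous_comp _ _ _ clamp phi).
    apply: continuous_max; first exact: cst_continuous.
    by apply: continuous_min; [exact: cvg_id|exact: cst_continuous].
  apply: differentiable_continuous; apply/derivable1_diffP; apply: dphi.
  by have /andP[] := clampP x; lra.
pose G : cumulative R R := HB.pack F (isCumulative.Build R _ R F ndF
  (right_continuousW cF)).
have eqF x : p < x < q -> \forall y \near x, phi y = F y.
  move=> xpq; near=> y; rewrite /F clampE//.
  by apply/andP; split; apply: ltW; near: y; [apply: lt_nbhsr|apply: lt_nbhsl];
    case/andP: xpq.
have dG x : p < x < q -> derivable G x 1.
  move=> xpq; apply: (near_eq_derivable (eqF _ xpq)).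
  by apply: dphi; lra.
have mG : measurable_fun `]p, q[ (EFin \o 'D_1 phi).
  apply/measurable_EFinP; apply: (eq_measurable_fun ('D_1 G)).
    move=> x; rewrite inE/= in_itv/= => xpq.
    by apply/esym/near_eq_derive; exact: eqF.
  apply: measurable_fun_derive1; first exact: measurable_itv.
  by move=> x; rewrite /= in_itv/=; exact: dG.
rewrite (integral_itv_bndoo _ _ mG).
transitivity (\int[lambda]_(x in `]p, q[) ('D_1 G x)%:E)%E.
  apply: eq_integral => x; rewrite inE/= in_itv/= => xpq.
  by congr EFin; apply: near_eq_derive; exact: eqF.
rewrite integral_derive_stieltjes//.
by rewrite /G /F/= !clampE// ?lexx ?pq.
Unshelve. all: by end_near. Qed.

End stieltjes_derive.

(** * Borel sets of row vectors *)

Section borel_rV.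
Variables (R : realType) (d : nat).
Local Notation rV := 'rV[R]_d.
Local Notation brV := (borel_rV R d).
Implicit Types (p q v x : rV) (i : 'I_d).

Definition lower_set q : set rV := [set v | forall i, v 0 i <= q 0 i].

Lemma forall_measurable dT (T : measurableType dT) (F : 'I_d -> set T) :
  (forall i, measurable (F i)) -> measurable [set t | forall i, F i t].
Proof.
move=> mF; have -> : [set t | forall i, F i t] = \bigcap_i F i.
  by apply/seteqP; split=> t Ft i; [move=> _|]; exact: Ft.
exact: fin_bigcap_measurable.
Qed.

Lemma rV_open_measurable (U : set rV) : open U -> measurable (U : set brV).
Proof. by move=> oU; exact: sub_sigma_algebra. Qed.

Lemma measurable_coord i : measurable_fun setT (fun v : brV => (v : rV) 0 i).
Proof.
apply: (measurability _ (RGenOInfty.measurableE R)) => _ [_ [c ->] <-].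
rewrite setTI; apply: rV_open_measurable.
have /continuousP := @coord_continuous R 1 d 0 i; apply.
exact: rray_open.
Qed.

(** The index type is countable, so a union of such cubes over any set of indices is a countable
    one. *)
Definition rat_box (c : 'rV[rat]_d * nat) : set rV :=
  [set v | forall i, `|ratr (c.1 0 i) - v 0 i| < c.2.+1%:R^-1].

Lemma rat_near (c r : R) : 0 < r -> exists q : rat, `|ratr q - c| < r.
Proof.
move=> r0; have /rat_in_itvoo[q] : c - r < c + r by lra.
rewrite in_itv/= => /andP[h1 h2]; exists q.
by rewrite ltr_norml; apply/andP; split; lra.
Qed.

Lemma open_bigcup_rat_box (U : set rV) : open U ->
  U = \bigcup_(c in [set c | rat_box c `<=` U]) rat_box c.
Proof.
move=> oU; apply/seteqP; split=> [v Uv|v [c cU]]; last exact: cU.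
have /nbhs_ballP[e/= e0 evU] : nbhs v U by exact: open_nbhs_nbhs.
have e20 : 0 < e / 2 by rewrite divr_gt0.
have [k _ /(_ k (leqnn k)) ke] := near_infty_natSinv_lt (PosNum e20).
have k0 : 0 < k.+1%:R^-1 :> R by rewrite invr_gt0.
have rP i : exists q : rat, `|ratr q - v 0 i| < k.+1%:R^-1 :> R.
  exact: rat_near.
have [f fP] := choice rP.
exists (\row_i f i, k).
  move=> w /= wk; apply: evU; split => // j i; rewrite (ord1 j).
  have := wk i; have := fP i; rewrite mxE /ball/= => h1 h2.
  rewrite (_ : _ - _ = (v 0 i - ratr (f i)) + (ratr (f i) - w 0 i)); last by lra.
  rewrite (le_lt_trans (ler_normD _ _))// distrC.
  by rewrite [ltRHS]splitr ltrD// (lt_trans _ ke).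
by move=> i; rewrite /= mxE.
Qed.

(** An open set is a countable union of rational cubes, and the preimage of a cube is a finite
    intersection of preimages of intervals under the coordinates. *)
Lemma measurable_rV dT (T : measurableType dT) (f : T -> rV) :
  (forall i, measurable_fun setT (fun t => f t 0 i)) ->
  measurable_fun setT (f : T -> brV).
Proof.
move=> mf; apply: (@measurability _ _ T brV setT f (@open rV) erefl) => _ [U oU <-]; rewrite setTI.
rewrite (open_bigcup_rat_box oU) preimage_bigcup bigcup_mkcond.
apply: countable_bigcupT_measurable => // c; case: ifPn => // _.
have -> : f @^-1` rat_box c = [set t | forall i, ((fun t => f t 0 i) @^-1`
    `]ratr (c.1 0 i) - c.2.+1%:R^-1, ratr (c.1 0 i) + c.2.+1%:R^-1[) t].
  by apply/seteqP; split=> t /= h i; have := h i;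
    rewrite in_itv/= -ltr_distlC distrC.
apply: forall_measurable => i; rewrite -[X in measurable X]setTI.
by apply: mf => //; exact: measurable_itv.
Qed.

Lemma lower_set_measurable q : measurable (lower_set q : set brV).
Proof.
have -> : lower_set q =
    [set v : brV | forall i, ((fun v : brV => (v : rV) 0 i) @^-1` `]-oo, q 0 i]) v].
  by apply/seteqP; split=> v /= h i; have := h i; rewrite in_itv.
apply: forall_measurable => i; rewrite -[X in measurable X]setTI.
by apply: measurable_coord => //; exact: measurable_itv.
Qed.

Lemma rV_nat_bound v : exists k : nat, forall i, v 0 i <= k%:R.
Proof.
exists (\max_(j < d) (Num.truncn (v 0%R j)).+1)%N => i.
apply: (@le_trans _ _ (Num.truncn (v 0 i)).+1%:R).
  by rewrite ltW// truncnS_gt.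
by rewrite ler_nat; exact: (leq_bigmax i).
Qed.

(** For the inclusion from left to right, the identity is measurable into the Borel sets as soon as
    its coordinates are; the half-space of all [v] with coordinate [i] at most [c] is the union over
    [k] of the lower sets with corner [c] at [i] and [k] elsewhere. *)
Lemma borel_rV_lower_set :
  (measurable : set (set brV)) = <<s [set lower_set q | q in setT] >>.
Proof.
apply/seteqP; split=> A.
  move=> mA; pose gT := g_sigma_algebraType [set lower_set q | q in [set: rV]].
  have mid : measurable_fun setT ((fun v => v) : gT -> brV).
    apply: measurable_rV => i.
    apply: (measurability _ (RGenOInfty.measurableE R)) => _ [_ [c ->] <-].
    rewrite setTI -[X in measurable X]setCK; apply: measurableC.
    have -> : ~` ((fun t : gT => (t : rV) 0 i) @^-1` `]c, +oo[) =
        \bigcup_(k : nat) lower_set (\row_j if j == i then c else k%:R).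
      apply/seteqP; split=> v /=; rewrite in_itv/= andbT.
        move=> /negP; rewrite -leNgt => vc.
        have [k vk] := rV_nat_bound v.
        by exists k => // j; rewrite mxE; case: eqP => [->|].
      by move=> [k _ /(_ i)]; rewrite mxE eqxx => vc; apply/negP; rewrite -leNgt.
    by apply: bigcupT_measurable => k; apply: sub_sigma_algebra; eexists.
  by have := mid measurableT _ mA; rewrite setTI.
apply: smallest_sub; first exact: sigma_algebra_measurable.
by move=> _ [q _ <-]; exact: lower_set_measurable.
Qed.

Lemma lower_setI p q :
  lower_set p `&` lower_set q = lower_set (\row_i Num.min (p 0 i) (q 0 i)).
Proof.
apply/seteqP; split=> v /=.
  by move=> [vp vq] i; rewrite mxE le_min vp vq.
by move=> h; split=> i; have := h i; rewrite mxE le_min => /andP[].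
Qed.

Lemma lower_set_cover : \bigcup_(k : nat) lower_set (const_mx k%:R) = setT.
Proof.
apply/seteqP; split=> // v _.
have [k vk] := rV_nat_bound v.
by exists k => // j; rewrite mxE.
Qed.

(** The lower sets form a generating pi-system that contains a countable cover of the space. *)
Lemma lower_set_measure_unique (m1 m2 : {measure set brV -> \bar R}) :
  (forall q, m1 (lower_set q) < +oo)%E ->
  (forall q, m1 (lower_set q) = m2 (lower_set q)) ->
  forall A, measurable A -> m1 A = m2 A.
Proof.
move=> m1oo m12 A mA.
apply: (@measure_unique _ R brV [set lower_set q | q in [set: rV]]
  (fun k => lower_set (const_mx k%:R))) => //.
- exact: borel_rV_lower_set.
- by move=> _ _ [p _ <-] [q _ <-]; rewrite lower_setI; eexists.
- exact: lower_set_cover.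
- by move=> _ [q _ <-].
Qed.

(** Its sections at a first component [x] are the lower sets, so the measure of sections, which is
    measurable in [x], is the distribution function. *)
Lemma lower_set_all_measurable :
  measurable [set xv : brV * brV | lower_set xv.1 xv.2].
Proof.
apply: forall_measurable => i.
have m1 : measurable_fun setT (fun xv : brV * brV => (xv.1 : rV) 0 i).
  exact: (measurableT_comp (measurable_coord i) measurable_fst).
have m2 : measurable_fun setT (fun xv : brV * brV => (xv.2 : rV) 0 i).
  exact: (measurableT_comp (measurable_coord i) measurable_snd).
have m12 := measurable_fun_ler m2 m1.
by have := m12 measurableT [set true] I; rewrite setTI.
Qed.

Lemma measurable_df (P : probability brV R) : measurable_fun setT (df P : brV -> R).
Proof.
apply/measurable_EFinP.
rewrite (_ : EFin \o _ = fun x => P (xsection [set xv : brV * brV | lower_set xv.1 xv.2] x)).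
  by apply: measurable_fun_xsection; exact: lower_set_all_measurable.
apply/funext => x /=; rewrite /df fineK ?fin_num_measure//.
  by congr (P _); apply/seteqP; split=> v /=; rewrite /xsection/= inE.
exact: lower_set_measurable.
Qed.

End borel_rV.

(** * Mixed derivatives and iterated integrals *)

(** Packages the image as a finite measure, so that a further product with it can be formed in
    [iter_integral_measure]. *)
Lemma finite_pushforward d1 d2 (T1 : measurableType d1) (T2 : measurableType d2)
    (R : realType) (m : {measure set T1 -> \bar R}) (f : T1 -> T2) :
  measurable_fun setT f -> (m setT < +oo)%E ->
  exists m' : {finite_measure set T2 -> \bar R},
    (m' : set T2 -> \bar R) = pushforward m f.
Proof.
move=> mf moo.
pose M : {measure set T2 -> \bar R} :=
  measure_function_pushforward__canonical__measure_function_Measure m mf.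
have Mfin : fin_num_fun M.
  move=> A mA; rewrite ge0_fin_numE//.
  rewrite (le_lt_trans (le_measure M _ _ (subsetT A))) ?inE//.
pose N : {finite_measure set T2 -> \bar R} :=
  HB.pack (Measure.sort M) (Measure.class M) (@Measure_isFinite.Build _ _ _ M Mfin).
by exists N.
Qed.

Section coordinates.
Variables (R : realType) (d : nat).
Local Notation rV := 'rV[R]_d.
Local Notation brV := (borel_rV R d).
Local Notation lambda := (@lebesgue_measure R).
Local Notation e_ i := (delta_mx 0 i : rV).
Implicit Types (p q v x : rV) (i j : 'I_d) (r : seq 'I_d) (G : rV -> R).

Definition upd x i (t : R) : rV := \row_j (if j == i then t else x 0 j).

Lemma updE x i t : upd x i t 0 i = t.
Proof. by rewrite mxE eqxx. Qed.

Lemma updNE x i t j : j != i -> upd x i t 0 j = x 0 j.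
Proof. by rewrite mxE => /negbTE ->. Qed.

Lemma upd_id x i : upd x i (x 0 i) = x.
Proof. by apply/rowP => j; rewrite mxE; case: eqP => [->|]. Qed.

Lemma updC x i j s t : i != j -> upd (upd x i s) j t = upd (upd x j t) i s.
Proof.
move=> ij; apply/rowP => k; rewrite !mxE.
by case: (eqVneq k j) => // ->; rewrite eq_sym (negbTE ij).
Qed.

Lemma upd_shift x i t h : h *: e_ i + upd x i t = upd x i (h + t).
Proof.
apply/rowP => j; rewrite !mxE eqxx/=.
by case: eqP => _; rewrite ?mulr1// mulr0 add0r.
Qed.

Let quotient_upd G x i (t : R) :
  (fun h : R => h^-1 *: ((G \o shift (upd x i t)) (h *: e_ i) - G (upd x i t))) =
  (fun h : R => h^-1 *: (((fun s => G (upd x i s)) \o shift t) (h *: (1 : R)) -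
                     G (upd x i t))).
Proof. by apply/funext => h /=; rewrite upd_shift /GRing.scale/= mulr1. Qed.

Lemma derive_upd G x i (t : R) :
  'D_(e_ i) G (upd x i t) = 'D_1 (fun s => G (upd x i s)) t.
Proof. by rewrite /derive quotient_upd. Qed.

Lemma derivable_upd G x i (t : R) :
  derivable G (upd x i t) (e_ i) <-> derivable (fun s => G (upd x i s)) t 1.
Proof. by rewrite /derivable quotient_upd. Qed.

Definition dcoord i G : rV -> R := fun x => 'D_(e_ i) G x.

(** Differentiates in the head of the list first, in the order opposite to [partial], so that an
    induction on [r] peels off the differentiation acting directly on [G]. *)
Fixpoint mixed r G : rV -> R := if r is i :: r' then mixed r' (dcoord i G) else G.

Lemma partial_rev r G : partial (rev r) G = mixed r G.
Proof.
elim: r G => // i r IH G; rewrite rev_cons /partial foldr_rcons.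
exact: IH.
Qed.

(* All the mixed derivatives of [G] over subsequences of [r] are required, so
   that the class is stable under products (Leibniz rule). *)
Fixpoint smooth r (A : set rV) G : Prop :=
  if r is i :: r' then
    [/\ forall x, A x -> derivable G x (e_ i), smooth r' A (dcoord i G) &
        smooth r' A G]
  else True.

(** The alternating sum of [G] over the vertices of the box spanned by [p] and [q] in the directions
    of [r]; only the coordinates of [x] outside [r] matter. For a distribution function it is the
    measure of a box. *)
Fixpoint box_diff r p q G x : R :=
  if r is i :: r' then
    box_diff r' p q G (upd x i (q 0 i)) - box_diff r' p q G (upd x i (p 0 i))
  else G x.

Lemma box_diff_upd r p q G x i s t : i \notin r ->
  box_diff r (upd p i s) (upd q i t) G x = box_diff r p q G x.
Proof.
elim: r x => // j r IH x; rewrite inE negb_or => /andP[ij ir] /=.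
by rewrite !IH// !updNE// eq_sym.
Qed.

Definition obox (a b : R) : set rV := [set x | forall i, a < x 0 i < b].

Lemma obox_upd a b x i t : obox a b x -> a < t < b -> obox a b (upd x i t).
Proof. by move=> ax at_ j; rewrite mxE; case: eqP. Qed.

(** Differentiation in direction [i] commutes with the differences because these act on other
    coordinates. *)
Lemma is_derive_box_diff r p q G x i (t a b : R) : i \notin r ->
  obox a b p -> obox a b q -> obox a b x -> a < t < b ->
  (forall x, obox a b x -> derivable G x (e_ i)) ->
  is_derive t 1 (fun s => box_diff r p q G (upd x i s))
    (box_diff r p q (dcoord i G) (upd x i t)).
Proof.
elim: r x => [|j r IH] x.
  move=> _ _ _ ax at_ dG; apply: DeriveDef; last by rewrite -derive_upd.
  by apply/derivable_upd/dG/obox_upd.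
rewrite inE negb_or => /andP[ij ir] ap aq ax at_ dG /=.
rewrite [X in is_derive _ _ X](_ : _ =
   (fun s => box_diff r p q G (upd (upd x j (q 0 j)) i s)) \-
   (fun s => box_diff r p q G (upd (upd x j (p 0 j)) i s))); last first.
  by apply/funext => s /=; rewrite !(@updC x i j).
rewrite !(@updC x i j)//.
by apply: is_deriveB; apply: IH => //; apply: obox_upd.
Qed.

Definition halfbox p q : set rV := [set v | forall i, p 0 i < v 0 i <= q 0 i].

Lemma halfbox_obox (a b : R) p q x : obox a b p -> obox a b q -> halfbox p q x ->
  obox a b x.
Proof.
move=> ap aq xpq i; have /andP[h1 h2] := xpq i.
have /andP[h3 _] := ap i; have /andP[_ h4] := aq i.
by rewrite (lt_trans h3) ?(le_lt_trans h2).
Qed.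

Section iterated_integral.
Variable l : {finite_measure set (measurableTypeR R) -> \bar R}.

(** The head of [r] is the outermost variable of integration. The measure [l] will be Lebesgue
    measure restricted to an interval. *)
Fixpoint iter_integral r (F : rV -> \bar R) x : \bar R :=
  if r is i :: r' then (\int[l]_t iter_integral r' F (upd x i t))%E else F x.

Lemma iter_integral_upd r F x i t : i \notin r ->
  iter_integral r F (upd x i t) = iter_integral r (fun y => F (upd y i t)) x.
Proof.
elim: r x => // j r IH x; rewrite inE negb_or => /andP[ij ir] /=.
by apply: eq_integral => s _; rewrite updC// IH.
Qed.

Lemma iter_integral_out r p q (g : rV -> \bar R) x i : i \notin r ->
  ~~ (p 0 i < x 0 i <= q 0 i) -> iter_integral r (g \_ (halfbox p q)) x = 0%E.
Proof.
elim: r x => [|j r IH] x.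
  move=> _ xi; rewrite /= patchN//; apply/negP; rewrite inE => /(_ i).
  exact/negP.
rewrite inE negb_or => /andP[ij ir] xi /=.
by apply: integral0_eq => t _; apply: IH; rewrite ?updNE.
Qed.

Lemma measurable_upd i :
  measurable_fun setT (fun yt : brV * measurableTypeR R => upd yt.1 i yt.2 : brV).
Proof.
apply: measurable_rV => j.
case: (eqVneq j i) => [->|ji].
  by under eq_fun do rewrite updE; exact: measurable_snd.
under eq_fun do rewrite updNE//.
exact: (measurableT_comp (measurable_coord j) measurable_fst).
Qed.

(** The measure does not depend on [F]. It starts as a Dirac mass at [x]; each further coordinate
    replaces [m] by the image of the product of [m] and [l] under overwriting coordinate [i], and
    Tonelli's theorem puts the new variable outermost. *)
Lemma iter_integral_measure r x : uniq r ->
  exists m : {finite_measure set brV -> \bar R},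
    forall F : brV -> \bar R, measurable_fun setT F -> (forall v, 0 <= F v)%E ->
      (\int[m]_v F v = iter_integral r F x)%E.
Proof.
elim: r => [_|i r IH].
  exists (dirac (x : brV)) => F mF F0.
  by rewrite integral_dirac//= diracE mem_set// mul1e.
move=> /= /andP[ir /IH[m mE]].
pose u (yt : brV * measurableTypeR R) : brV := upd yt.1 i yt.2.
have mu_ : measurable_fun setT u := measurable_upd i.
pose ml : {measure set (brV * measurableTypeR R) -> \bar R} := (m \x l)%E.
have mloo : (ml setT < +oo)%E.
  rewrite -setXTT [X in (X < _)%E]product_measure1E//.
  by rewrite lte_mul_pinfty// ?fin_num_measure// ltey_eq fin_num_measure.
have [m' m'E] := finite_pushforward mu_ mloo.
exists m' => F mF F0.
have mFu : measurable_fun setT (F \o u) by exact: measurableT_comp mF mu_.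
rewrite m'E ge0_integral_pushforward//= preimage_setT /ml.
rewrite (fubini_tonelli2 (m1 := m) (m2 := l) (F \o u) mFu)//=.
apply: eq_integral => t _; rewrite iter_integral_upd// -mE//.
exact: (measurableT_comp mFu (measurable_pair2 t)).
Qed.

End iterated_integral.
End coordinates.

(** * Mixed derivatives of distribution functions as densities *)

Section density.
Variables (R : realType) (d : nat).
Local Notation rV := 'rV[R]_d.
Local Notation brV := (borel_rV R d).
Local Notation lambda := (@lebesgue_measure R).
Local Notation e_ i := (delta_mx 0 i : rV).
Implicit Types (p q v x : rV) (i j : 'I_d) (r : seq 'I_d) (G : rV -> R).

(** Nonnegative differences over [i :: r] say that the differences over [r] are nondecreasing in
    coordinate [i], so their derivative in that coordinate is nonnegative. *)
Lemma box_diff_dcoord_ge0 r i G (a b : R) : i \notin r ->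
  (forall x, obox a b x -> derivable G x (e_ i)) ->
  (forall p q x, obox a b p -> obox a b q -> (forall j, p 0 j <= q 0 j) ->
    obox a b x -> 0 <= box_diff (i :: r) p q G x) ->
  forall p q x, obox a b p -> obox a b q -> (forall j, p 0 j <= q 0 j) ->
    obox a b x -> 0 <= box_diff r p q (dcoord i G) x.
Proof.
move=> ir dG G0 p q x ap aq pq ax.
rewrite -{1}(upd_id x i).
have der := is_derive_box_diff ir ap aq ax (ax i) dG.
rewrite -(@derive_val _ _ _ _ _ _ _ der).
apply: (derive_local_nondecreasing_ge0 (ax i)); last exact: ex_derive.
move=> s u as_ su ub; rewrite -subr_ge0.
(* The hypothesis is applied to the box whose side in direction [i] runs from [s] to [u]; the other
   sides are unchanged. *)
have := G0 (upd p i s) (upd q i u) x; rewrite /= !updE !box_diff_upd//; apply=> //.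
- by apply: obox_upd => //; rewrite as_ (le_lt_trans su).
- by apply: obox_upd => //; rewrite ub andbT (lt_le_trans as_).
- by move=> j; rewrite !mxE; case: eqP.
Qed.

Lemma mixed_ge0 r G (a b : R) : uniq r -> smooth r (obox a b) G ->
  (forall p q x, obox a b p -> obox a b q -> (forall j, p 0 j <= q 0 j) ->
    obox a b x -> 0 <= box_diff r p q G x) ->
  forall x, obox a b x -> 0 <= mixed r G x.
Proof.
elim: r G => [|i r IH] G /=.
  by move=> _ _ G0 x ax; apply: (G0 x x).
move=> /andP[ir ur] [dG sG _] G0; apply: IH => //.
exact: box_diff_dcoord_ge0.
Qed.

Section fubini.
Variables (a b : R) (l : {finite_measure set (measurableTypeR R) -> \bar R}).
Hypothesis lE : forall A : set R, measurable A -> A `<=` `]a, b[ -> l A = lambda A.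

(** After the inner integrations the integrand is the derivative, in the outermost variable, of a
    nondecreasing function, so the one-variable theorem applies. Coordinates outside [r] are not
    integrated and must already satisfy the constraints of the box. *)
Lemma iter_integral_mixed r G p q x : uniq r -> smooth r (obox a b) G ->
  (forall p q x, obox a b p -> obox a b q -> (forall j, p 0 j <= q 0 j) ->
    obox a b x -> 0 <= box_diff r p q G x) ->
  obox a b p -> obox a b q -> (forall j, p 0 j <= q 0 j) -> obox a b x ->
  (forall j, j \notin r -> p 0 j < x 0 j <= q 0 j) ->
  iter_integral l r ((fun v => (mixed r G v)%:E) \_ (halfbox p q)) x =
    (box_diff r p q G x)%:E.
Proof.
move=> + + + ap aq pq.
elim: r G x => [|i r IH] G x.
  by move=> _ _ _ ax xpq; rewrite /= patchT// inE => j; exact: xpq.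
move=> /= /andP[ir ur] [dG sG _] G0 ax xpq.
have G0' := box_diff_dcoord_ge0 ir dG G0.
pose I : set R := `]p 0 i, q 0 i]%classic.
have Iab : I `<=` `]a, b[.
  move=> t; rewrite /I /= !in_itv/= => /andP[pt tq].
  by have /andP[h1 _] := ap i; have /andP[_ h2] := aq i; rewrite (lt_trans h1 pt) (le_lt_trans tq h2).
have mI : measurable (I : set (measurableTypeR R)) by exact: measurable_itv.
transitivity (\int[l]_(t in I) ('D_1 (fun s => box_diff r p q G (upd x i s)) t)%:E)%E.
  rewrite [RHS]integral_mkcond; apply: eq_integral => t _.
  rewrite patchE; case: ifPn => [|]; rewrite ?inE ?notin_setE /I/= in_itv/=.
    move=> tpq.
    have at_ : a < t < b by have := Iab (t : R); rewrite /I /= !in_itv/=; apply.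
    rewrite IH//; first last.
    - move=> j jr; case: (eqVneq j i) => [->|ji]; first by rewrite updE.
      by rewrite updNE// xpq// inE negb_or ji.
    - exact: obox_upd.
    have der := is_derive_box_diff ir ap aq ax at_ dG.
    by rewrite (@derive_val _ _ _ _ _ _ _ der).
  by move=> /negP tpq; apply: (@iter_integral_out _ _ _ _ _ _ _ _ i) => //; rewrite updE.
transitivity (\int[lambda]_(t in I) ('D_1 (fun s => box_diff r p q G (upd x i s)) t)%:E)%E.
  by apply: eq_measure_integral => A mA AI; apply: lE => //; exact: subset_trans Iab.
have /andP[ap1 _] := ap i; have /andP[_ aq2] := aq i.
rewrite (integral_derive_nondecreasing ap1 (pq i) aq2)//.
- move=> s u as_ su ub; rewrite -subr_ge0.
  have := G0 (upd p i s) (upd q i u) x; rewrite /= !updE !box_diff_upd//; apply=> //.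
  + by apply: obox_upd => //; rewrite as_ (le_lt_trans su).
  + by apply: obox_upd => //; rewrite ub andbT (lt_le_trans as_).
  + by move=> j; rewrite !mxE; case: eqP.
- by move=> t at_; have [] := is_derive_box_diff ir ap aq ax at_ dG.
Qed.
End fubini.

Section box_probability.
Variable P : probability brV R.

(** Each difference in a coordinate removes from a set its subset where that coordinate is at most
    [p 0 i]; the two are nested because [p <= q]. *)
Lemma box_diff_df r p q x : uniq r -> (forall i, p 0 i <= q 0 i) ->
  (box_diff r p q (df P) x)%:E =
  P [set v : rV | forall i, if i \in r then p 0 i < v 0 i <= q 0 i
                            else v 0 i <= x 0 i].
Proof.
move=> + pq; elim: r x => [|i r IH] x.
  by move=> _ /=; rewrite /df fineK// fin_num_measure//; exact: lower_set_measurable.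
have mB s y : measurable ([set v : rV | forall i, if i \in s then p 0 i < v 0 i <= q 0 i
                            else v 0 i <= y 0 i] : set brV).
  apply: forall_measurable => j.
  have mle c : measurable ([set v : rV | v 0 j <= c] : set brV).
    rewrite (_ : mkset _ = setT `&` (fun v : brV => (v : rV) 0 j) @^-1` `]-oo, c]).
      by apply: measurable_coord => //; exact: measurable_itv.
    by apply/seteqP; split=> v /=; rewrite in_itv/= => //; case.
  case: (j \in s); last exact: mle.
  rewrite (_ : (fun _ => _) = [set v : rV | v 0 j <= q 0 j] `\` [set v : rV | v 0 j <= p 0 j]).
    exact: measurableD.
  apply/seteqP; split=> v /=; first by move=> /andP[pv vq]; split => //; apply/negP; rewrite -ltNge.
  by move=> [vq /negP]; rewrite -ltNge => pv; rewrite pv.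
move=> /= /andP[ir ur]; rewrite EFinB !IH//.
set A := (X in (P X - _)%E); set B := (X in (_ - P X)%E).
have BA : B `<=` A.
  move=> v Bv j; have := Bv j; case: ifPn => // jr.
  by case: (eqVneq j i) => [->|ji]; rewrite ?updE ?updNE// => /le_trans; apply.
have -> : (P A - P B = P (A `\` B))%E.
  rewrite measureD ?(setIidr BA)//; [exact: mB|exact: mB|].
  by rewrite -ge0_fin_numE// fin_num_measure//; exact: mB.
congr (P _); apply/seteqP; split=> v /=.
  move=> [Av nB] j; have := Av j; rewrite inE; case: (eqVneq j i) => [->|ji]/=.
    rewrite (negbTE ir) updE => ->; rewrite andbT ltNge; apply/negP => vp.
    apply: nB => k; have := Av k; case: ifP => // _.
    by case: (eqVneq k i) => [->|ki]; rewrite ?updE ?updNE.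
  by case: ifPn => // _; rewrite updNE.
move=> h; split=> [j|/(_ i)].
  have := h j; rewrite inE; case: (eqVneq j i) => [->|ji]/=.
    by rewrite (negbTE ir) updE => /andP[].
  by case: ifPn => // _; rewrite updNE.
have := h i; rewrite inE eqxx/= (negbTE ir) updE => /andP[+ _].
by rewrite ltNge => /negP.
Qed.

End box_probability.

End density.

Lemma density_measure dT (T : measurableType dT) (R : realType)
    (m : {measure set T -> \bar R}) (g : T -> \bar R) :
  measurable_fun setT g -> (forall x, 0 <= g x)%E ->
  exists nu : {measure set T -> \bar R},
    forall A, nu A = (\int[m]_(x in A) g x)%E.
Proof.
move=> mg g0.
pose nu (A : set T) := (\int[m]_(x in A) g x)%E.
have nu0 : nu set0 = 0%E by rewrite /nu integral_set0.
have nuge0 A : (0 <= nu A)%E by exact: integral_ge0.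
have nuadd : semi_sigma_additive nu.
  move=> F mF tF mUF; rewrite /nu ge0_integral_bigcup//; last exact: measurable_funTS.
  by apply: is_cvg_nneseries => n _ _; exact: integral_ge0.
pose N : {measure set T -> \bar R} :=
  HB.pack nu (isMeasure.Build _ _ _ nu nu0 nuge0 nuadd).
by exists N.
Qed.

Section density.
Variables (R : realType) (d : nat).
Local Notation rV := 'rV[R]_d.
Local Notation brV := (borel_rV R d).
Local Notation lambda := (@lebesgue_measure R).
Local Notation e_ i := (delta_mx 0 i : rV).
Implicit Types (p q v x : rV) (i j : 'I_d) (r : seq 'I_d) (G : rV -> R).

Lemma near_obox (a b : R) x : obox a b x -> \forall y \near x, obox a b y.
Proof.
move=> ax; suff h i : \forall y \near x, a < (y : rV) 0 i < b by exact: filter_forall h.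
have /andP[h1 h2] := ax i.
have c := @coord_continuous R 1 d 0 i x.
near=> y; apply/andP; split; near: y.
- exact: (c _ (lt_nbhsr h1)).
- exact: (c _ (lt_nbhsl h2)).
Unshelve. all: by end_near. Qed.

Lemma obox_measurable (a b : R) : measurable (obox a b : set brV).
Proof.
apply: rV_open_measurable; rewrite openE => x ax; exact: near_obox.
Qed.

Lemma halfbox_measurable p q : measurable (halfbox p q : set brV).
Proof.
have -> : halfbox p q =
    [set v : brV | forall i, ((fun v : brV => (v : rV) 0 i) @^-1` `]p 0 i, q 0 i]) v].
  by apply/seteqP; split=> v /= h i; have := h i; rewrite in_itv.
apply: forall_measurable => i; rewrite -[X in measurable X]setTI.
by apply: measurable_coord => //; exact: measurable_itv.
Qed.

(** [G] is extended by 0 so that the difference quotients are measurable everywhere; at a point of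
    the cube the shifted argument eventually lies in the cube too, and the extension is
    invisible. *)
Lemma measurable_dcoord i G (a b : R) :
  measurable_fun (obox a b : set brV) (G : brV -> R) ->
  (forall x, obox a b x -> derivable G x (e_ i)) ->
  measurable_fun (obox a b : set brV) (dcoord i G : brV -> R).
Proof.
move=> /(measurable_restrictT _ (obox_measurable a b)) mG dG.
pose H := (G : brV -> R) \_ (obox a b).
have mshift (n : nat) : measurable_fun setT
    (fun x : brV => (x : rV) + n.+1%:R^-1 *: e_ i : brV).
  apply: measurable_rV => j.
  under eq_fun do rewrite !mxE.
  by apply: measurable_funD => //; exact: measurable_coord.
apply: (@measurable_fun_cvg _ brV R _
  (fun n x => n.+1%:R * (H ((x : rV) + n.+1%:R^-1 *: e_ i) - H x))).
  move=> n; apply: measurable_funTS.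
  apply: measurable_funM => //; apply: measurable_funB => //.
  exact: (measurableT_comp mG (mshift n)).
move=> x ax; apply: cvg_trans (derive_seq (dG x ax)).
apply: near_eq_cvg; have /andP[_ h2] := ax i.
have bx0 : 0 < b - x 0 i by rewrite subr_gt0.
near=> n; rewrite /H !patchT ?inE//.
have -> : x + n.+1%:R^-1 *: e_ i = upd x i (n.+1%:R^-1 + x 0 i).
  by rewrite -upd_shift upd_id addrC.
apply: obox_upd => //; apply/andP; split.
  by rewrite (lt_trans (proj1 (andP (ax i))))// ltrDr invr_gt0.
by rewrite -ltrBrDr; near: n; exact: near_infty_natSinv_lt (PosNum bx0).
Unshelve. all: by end_near. Qed.

Lemma measurable_mixed r G (a b : R) : smooth r (obox a b) G ->
  measurable_fun (obox a b : set brV) (G : brV -> R) ->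
  measurable_fun (obox a b : set brV) (mixed r G : brV -> R).
Proof.
elim: r G => // i r IH G /= [dG sG _] mG; apply: IH => //.
exact: measurable_dcoord.
Qed.

Lemma box_diff_df_ge0 (P : probability brV R) r (a b : R) : uniq r ->
  forall p q x, obox a b p -> obox a b q -> (forall j, p 0 j <= q 0 j) ->
    obox a b x -> 0 <= box_diff r p q (df P) x.
Proof.
by move=> ur p q x _ _ pq _; rewrite -lee_fin box_diff_df// measure_ge0.
Qed.

Definition density r (P : probability brV R) (a b : R) : brV -> \bar R :=
  (fun x => (mixed r (df P) x)%:E) \_ (obox a b).

Lemma density_ge0 r (P : probability brV R) (a b : R) x : uniq r -> smooth r (obox a b) (df P) ->
  (0 <= density r P a b x)%E.
Proof.
move=> ur sP; rewrite /density patchE; case: ifPn => //; rewrite inE => ax.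
by rewrite lee_fin (mixed_ge0 ur sP)//; exact: box_diff_df_ge0.
Qed.

Lemma measurable_density r (P : probability brV R) (a b : R) : smooth r (obox a b) (df P) ->
  measurable_fun setT (density r P a b).
Proof.
move=> sP; apply/(measurable_restrictT _ (obox_measurable a b)).
apply/measurable_EFinP; apply: measurable_mixed => //.
by apply: measurable_funTS; exact: measurable_df.
Qed.

(* [m] is Lebesgue measure on the box: it does not depend on [P]. *)
Lemma exists_density_measure r (a b : R) : uniq r -> (forall i, i \in r) -> a < b ->
  exists m : {measure set brV -> \bar R},
    forall P : probability brV R, smooth r (obox a b) (df P) ->
    forall p q, obox a b p -> obox a b q -> (forall i, p 0 i <= q 0 i) ->
    forall A : set brV, measurable A ->
      P (A `&` halfbox p q) = (\int[m]_(v in A `&` halfbox p q) density r P a b v)%E.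
Proof.
move=> ur rT ab.
have abfin : (lambda `]a, b[%classic < +oo)%E.
  by rewrite lebesgue_measure_itv/=; case: ifP => // _; rewrite -EFinB ltry.
have mab : measurable (`]a, b[%classic : set (measurableTypeR R)) by exact: measurable_itv.
pose l : {finite_measure set (measurableTypeR R) -> \bar R} := mfrestr mab abfin.
have lE (A : set R) : measurable A -> A `<=` `]a, b[ -> l A = lambda A.
  by move=> mA Aab; rewrite /l/= /mfrestr /mrestr setIidl.
(* Any point of the cube serves as starting point, since [r] lists all the coordinates and each is
   overwritten. *)
pose x0 : rV := const_mx ((a + b) / 2).
have ax0 : obox a b x0 by move=> i; rewrite mxE; apply/andP; split; lra.
have [m mE] := iter_integral_measure l x0 ur.
exists m => P sP p q ap aq pq A mA.
have fge0 x := density_ge0 x ur sP.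
have mf := measurable_density sP.
have boxE p' q' : obox a b p' -> obox a b q' -> (forall i, p' 0 i <= q' 0 i) ->
    P (halfbox p' q') = (\int[m]_(v in halfbox p' q') density r P a b v)%E.
  move=> ap' aq' pq'.
  have densE : density r P a b \_ (halfbox p' q') =
      (fun v => (mixed r (df P) v)%:E) \_ (halfbox p' q').
    apply/funext => v; rewrite !patchE; case: ifPn => //; rewrite inE => vpq.
    by rewrite /density patchT// inE; exact: halfbox_obox vpq.
  have -> : P (halfbox p' q') = (box_diff r p' q' (df P) x0)%:E.
    rewrite box_diff_df//; congr (P _); apply/seteqP; split=> v /= h i.
      by rewrite rT; exact: h.
    by have := h i; rewrite rT.
  rewrite -(iter_integral_mixed lE ur sP) //; first last.
  - by move=> j; rewrite rT.
  - exact: box_diff_df_ge0.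
  rewrite integral_mkcond -densE -mE//.
    by exact/(measurable_restrictT _ (halfbox_measurable _ _))/measurable_funTS.
  by move=> v; rewrite patchE; case: ifP.
pose f : brV -> \bar R := density r P a b \_ (halfbox p q).
have mhf : measurable_fun setT f.
  by exact/(measurable_restrictT _ (halfbox_measurable _ _))/measurable_funTS.
have f0 x : (0 <= f x)%E by rewrite /f patchE; case: ifP.
have [nu nuE] := density_measure m mhf f0.
rewrite integral_mkcondr -/f -nuE.
(* Both sides are measures in [A], compared on lower sets: a lower set meets the box in a half-open
   box with corners in the cube, covered by [boxE], or not at all. *)
pose P' : {measure set brV -> \bar R} := mrestr P (halfbox_measurable p q).
rewrite -[LHS]/(P' A).
apply: lower_set_measure_unique => // [q'|q'].
  by rewrite /P'/= /mrestr ltey_eq fin_num_measure//; apply: measurableI;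
    [exact: lower_set_measurable|exact: halfbox_measurable].
rewrite nuE /f -integral_mkcondr /P'/= /mrestr.
have [|] := pselect (forall i, p 0 i <= q' 0 i); last first.
  move=> npq; rewrite (_ : _ `&` _ = set0); first by rewrite measure0 integral_set0.
  rewrite -subset0 => v [vq' vpq]; apply: npq => i.
  by have /andP[h _] := vpq i; rewrite ltW// (lt_le_trans h).
move=> pq'.
have -> : lower_set q' `&` halfbox p q = halfbox p (\row_i Num.min (q 0 i) (q' 0 i)).
  apply/seteqP; split=> v /=.
    by move=> [vq' vpq] i; have /andP[h1 h2] := vpq i; rewrite mxE h1 le_min h2/= vq'.
  move=> h; split=> i; have /andP[] := h i; rewrite mxE le_min => h1 /andP[h2 h3] //.
  by rewrite h1.
apply: boxE => //.
  move=> i; rewrite mxE.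
  have /andP[h1 _] := ap i; have /andP[_ h2] := aq i.
  by rewrite lt_min (lt_le_trans h1 (pq i)) (lt_le_trans h1 (pq' i)) gt_min h2.
by move=> i; rewrite mxE le_min pq pq'.
Qed.

End density.

(** * Scheffé's argument *)

Section scheffe.
Variables (R : realType) (d : nat).
Local Notation rV := 'rV[R]_d.
Local Notation brV := (borel_rV R d).
Implicit Types (p q v x : rV) (i j : 'I_d) (r : seq 'I_d) (G : rV -> R).

(** The density formula holds on half-open boxes with corners inside the open cube; such boxes
    exhaust the cube, by continuity from below. *)
Lemma obox_halfbox (P : probability brV R) (a b e : R) : a < b -> 0 < e ->
  exists p q, [/\ obox a b p, obox a b q, (forall i, p 0 i <= q 0 i) &
    (P (obox a b) - e%:E <= P (halfbox p q))%E].
Proof.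
move=> ab e0.
(* Starting at half the side length ensures [a + h k <= b - h k] for every [k]. *)
pose h k : R := (b - a) / k.+2%:R.
have ba0 : 0 < b - a by rewrite subr_gt0.
have h0 k : 0 < h k by rewrite divr_gt0.
have hle m n : (m <= n)%N -> h n <= h m.
  by move=> mn; rewrite ler_pM2l// lef_pV2 ?posrE// ler_nat.
have h2 k : a + h k <= b - h k.
  have : h k <= (b - a) / 2 by rewrite ler_pM2l// lef_pV2 ?posrE// ler_nat.
  by move: (h k) => hk; lra.
pose p k : rV := const_mx (a + h k); pose q k : rV := const_mx (b - h k).
pose K k : set brV := halfbox (p k) (q k).
have mK k : measurable (K k) by exact: halfbox_measurable.
have hsmall (x : R) : 0 < x -> exists k : nat, h k < x.
  move=> x0; have xb : 0 < x / (b - a) by rewrite divr_gt0.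
  have [k _ /(_ k (leqnn k)) /= kx] := near_infty_natSinv_lt (PosNum xb).
  exists k; rewrite /h mulrC -ltr_pdivlMr// (le_lt_trans _ kx)//.
  by rewrite lef_pV2 ?posrE// ler_nat.
have UK : \bigcup_k K k = obox a b.
  apply/seteqP; split=> [v [k _ vk] i|v av].
    have := vk i; rewrite !mxE => /andP[h1 h3]; have := h0 k => hk.
    by rewrite (lt_trans _ h1) ?ltrDl// (le_lt_trans h3)// ltrBlDr ltrDl.
  have [k kP] : exists k : nat, forall i, h k < v 0 i - a /\ h k < b - v 0 i.
    have hi i : \forall k \near \oo, h k < v 0 i - a /\ h k < b - v 0 i.
      have /andP[h1 h3] := av i.
      have [k1 k1P] := hsmall (v 0 i - a) (ltac:(rewrite subr_gt0//)).
      have [k2 k2P] := hsmall (b - v 0 i) (ltac:(rewrite subr_gt0//)).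
      exists (maxn k1 k2) => // k /=; rewrite geq_max => /andP[kk1 kk2].
      by split; [exact: le_lt_trans (hle _ _ kk1) k1P|exact: le_lt_trans (hle _ _ kk2) k2P].
    have /= [k _ /(_ k (leqnn k)) kP] := filter_forall _ hi.
    by exists k.
  exists k => // i; rewrite !mxE; have [h1 h3] := kP i.
  by rewrite -ltrBrDl h1/= lerBrDr -lerBrDl ltW.
have ndK : nondecreasing_seq K.
  move=> m n mn; apply/subsetPset => v vm i; have := vm i; rewrite !mxE => /andP[h1 h3].
  by rewrite (le_lt_trans _ h1) ?lerD2l ?hle// (le_trans h3)// lerD2l lerN2 hle.
have cK := nondecreasing_cvg_mu (mu := P) mK (bigcupT_measurable _ mK) ndK.
rewrite UK in cK.
have fP : P (obox a b) \is a fin_num by rewrite fin_num_measure//; exact: obox_measurable.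
have e1 : (P (obox a b) - e%:E < P (obox a b))%E.
  by rewrite -(fineK fP) -EFinB lte_fin ltrBlDr ltrDl.
have [n _ /(_ n (leqnn n)) /ltW hn] : \forall n \near \oo, (P (obox a b) - e%:E < P (K n))%E :=
  cK _ (open_ereal_gt' e1).
exists (p n), (q n); split=> //.
- by move=> i; rewrite mxE ltrDl h0 (le_lt_trans (h2 n))// ltrBlDr ltrDl h0.
- by move=> i; rewrite mxE (lt_le_trans _ (h2 n)) ?ltrDl ?h0// ltrBlDr ltrDl h0.
- by move=> i; rewrite !mxE.
Qed.

Lemma neg_orthant_obox (P : probability brV R) (e : R) : P neg_orthant = 1%E ->
  0 < e -> exists2 a : R, a < 0 & (1 - e%:E <= P (obox a 0))%E.
Proof.
move=> P1 e0.
pose K (k : nat) : set brV := obox (- k.+1%:R) 0.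
have mK k : measurable (K k) by exact: obox_measurable.
have UK : \bigcup_k K k = neg_orthant.
  apply/seteqP; split=> [v [k _ vk] i|v v0].
    by have /andP[] := vk i.
  have [k kv] := rV_nat_bound (- v).
  exists k => // i; rewrite v0 andbT ltrNl.
  by have := kv i; rewrite mxE => /le_lt_trans; apply; rewrite ltr_nat.
have ndK : nondecreasing_seq K.
  move=> m n mn; apply/subsetPset => v vm i; have /andP[h1 ->] := vm i.
  by rewrite andbT (le_lt_trans _ h1)// lerN2 ler_nat.
have cK := nondecreasing_cvg_mu (mu := P) mK (bigcupT_measurable _ mK) ndK.
rewrite UK [X in _ --> X]P1 in cK.
have e1 : (1 - e%:E < 1)%E by rewrite -EFinB lte_fin ltrBlDr ltrDl.
have [n _ /(_ n (leqnn n)) /ltW hn] : \forall n \near \oo, (1 - e%:E < P (K n))%E :=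
  cK _ (open_ereal_gt' e1).
by exists (- n.+1%:R) => //; rewrite oppr_lt0.
Qed.

(** The 3 counts one [e] for the mass of [P] outside the cube, one for shrinking the cube to a
    half-open box [K], and one for the integral over [K] of the positive part of the difference of
    the densities. *)
Theorem scheffe_density (Pn : nat -> probability brV R) (P : probability brV R) r
    (a b e : R) :
  uniq r -> (forall i, i \in r) -> a < b -> 0 < e ->
  (1 - e%:E <= P (obox a b))%E ->
  (\forall n \near \oo, smooth r (obox a b) (df (Pn n))) ->
  smooth r (obox a b) (df P) ->
  (forall x, obox a b x ->
    (fun n => mixed r (df (Pn n)) x) @ \oo --> mixed r (df P) x) ->
  \forall n \near \oo, forall A : set brV, measurable A ->
    (P A <= Pn n A + (3 * e)%:E)%E.
Proof.
move=> ur rT ab e0 P1 sPn sP cPn.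
have [p [q [ap aq pq PK0]]] := obox_halfbox P ab e0.
pose K : set brV := halfbox p q.
have Pk : (1 - (2 * e)%:E <= P K)%E.
  apply: le_trans PK0; rewrite leeBrDr//; apply: le_trans P1.
  by rewrite -!EFinB -EFinD lee_fin; lra.
have mK : measurable K by exact: halfbox_measurable.
have [m mE] := exists_density_measure ur rT ab.
have [N _ sN] := sPn.
pose f := density r P a b.
(* The shift by [N] makes every term smooth, hence every [fn n] measurable and nonnegative. *)
pose fn n := density r (Pn (n + N)%N) a b.
have sn n : smooth r (obox a b) (df (Pn (n + N)%N)) by apply: sN; exact: leq_addl.
have mf : measurable_fun setT f by exact: measurable_density.
have mfn n : measurable_fun setT (fn n) by exact: measurable_density.
have f0 x : (0 <= f x)%E by exact: density_ge0.
have fn0 n x : (0 <= fn n x)%E by exact: density_ge0.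
(* Since [fn n] is nonnegative, this positive part is at most [f], whose integral over [K] is [P K];
   dominated convergence needs no other bound. *)
pose g n (x : brV) : \bar R := maxe (f x - fn n x)%E 0%E.
have g0 n x : (0 <= g n x)%E by rewrite /g le_max lexx orbT.
have mg n : measurable_fun setT (g n).
  by apply: measurable_maxe => //; exact: emeasurable_funB.
have fE x : K x -> f x = (mixed r (df P) x)%:E.
  by move=> Kx; rewrite /f /density patchT// inE; exact: halfbox_obox Kx.
have fnE n x : K x -> fn n x = (mixed r (df (Pn (n + N)%N)) x)%:E.
  by move=> Kx; rewrite /fn /density patchT// inE; exact: halfbox_obox Kx.
have gf n x : (g n x <= f x)%E.
  by rewrite /g ge_max f0 andbT leeBlDr ?leeDl// /fn /density patchE; case: ifP.
have PK (A : set brV) : measurable A -> P (A `&` K) = (\int[m]_(v in A `&` K) f v)%E.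
  by move=> mA; apply: mE.
have PnK n (A : set brV) : measurable A -> Pn (n + N)%N (A `&` K) = (\int[m]_(v in A `&` K) fn n v)%E.
  by move=> mA; apply: mE.
have intf : m.-integrable K f.
  apply/integrableP; split; first exact: measurable_funTS.
  under eq_integral do rewrite gee0_abs//.
  have := PK setT measurableT; rewrite setTI => <-.
  by rewrite ltey_eq fin_num_measure.
have cg : (\int[m]_(x in K) g n x)%E @[n --> \oo] --> 0%E.
  have -> : 0%E = (\int[m]_(x in K) (cst 0%E x : \bar R))%E by rewrite integral0.
  apply: (dominated_cvg mK (g := f)) => //.
  - by move=> n; exact: measurable_funTS.
  - move=> x Kx.
    have x0 : obox a b x := halfbox_obox ap aq Kx.
    have -> : (fun n => g n x) = EFin \o
        (fun n => Num.max (mixed r (df P) x - mixed r (df (Pn (n + N)%N)) x) 0).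
      by apply/funext => n /=; rewrite /g fE// fnE// -EFinB -EFin_max.
    apply: cvg_EFin; first exact: nearW.
    apply: (@squeeze_cvgr _ _ _ _ (cst 0)
      (fun n => `|mixed r (df P) x - mixed r (df (Pn (n + N)%N)) x|)).
    + by apply: nearW => n /=; rewrite le_max lexx orbT ge_max ler_norm normr_ge0.
    + exact: cvg_cst.
    + rewrite -[X in _ --> X](normr0 R) -(subrr (mixed r (df P) x)).
      apply: cvg_norm; apply: cvgB; first exact: cvg_cst.
      by rewrite (cvg_shiftn N (fun n => mixed r (df (Pn n)) x)); exact: cPn.
  - by move=> x /fE ->.
  - by move=> n x Kx; rewrite gee0_abs.
have {cg} : \forall n \near \oo, (\int[m]_(x in K) g n x <= e%:E)%E.
  have e2E : (0 < e%:E)%E by rewrite lte_fin.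
  have : \forall n \near \oo, (\int[m]_(x in K) g n x < e%:E)%E :=
    cg _ (open_ereal_lt' e2E).
  by apply: filterS => n /ltW.
move=> [M _ hM]; exists (M + N)%N => // n /= MNn A mA.
have Nn : (N <= n)%N by rewrite (leq_trans _ MNn)// leq_addl.
have := hM (n - N)%N; rewrite /= leq_subRL// addnC => /(_ MNn) {}hM.
have mAK : measurable (A `&` K) by exact: measurableI.
have PKc : (P (A `\` K) <= (2 * e)%:E)%E.
  apply: (@le_trans _ _ (P (~` K))).
    by apply: le_measure; rewrite ?inE; [exact: measurableD|exact: measurableC|move=> v []].
  by rewrite probability_setC// leeBlDr ?fin_num_measure// addeC -leeBlDr.
have step : (P (A `&` K) <= Pn n (A `&` K) + e%:E)%E.
  rewrite -{1}(subnK Nn) PK// PnK//.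
  apply: (@le_trans _ _ (\int[m]_(v in A `&` K) (fn (n - N)%N v + g (n - N)%N v))%E).
    apply: ge0_le_integral => //.
    - exact: measurable_funTS.
    - by apply: measurable_funTS; exact: emeasurable_funD.
    - move=> x [_ Kx]; rewrite -leeBlDl ?fnE//.
      by rewrite /g fE// fnE// le_max lexx.
  rewrite ge0_integralD//; [|exact: measurable_funTS|exact: measurable_funTS].
  rewrite leeD2l// (le_trans _ hM)//; apply: ge0_subset_integral => //.
  exact: measurable_funTS.
rewrite -{1}(setUIDK A K) measureU//; first last.
- by rewrite setDE setIACA setICr setI0.
- exact: measurableD.
rewrite (le_trans (leeD step PKc))// -addeA -EFinD (_ : e + 2 * e = 3 * e) ?leeD2r//; last by ring.
by apply: le_measure; rewrite ?inE.
Qed.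

End scheffe.

(** * Calculus of mixed derivatives *)

Section calculus.
Variables (R : realType) (d : nat).
Local Notation rV := 'rV[R]_d.
Local Notation e_ i := (delta_mx 0 i : rV).
Implicit Types (x : rV) (i j : 'I_d) (r : seq 'I_d) (F G : rV -> R) (A B : set rV).

Definition near_stable A := forall x, A x -> \forall y \near x, A y.

Lemma is_derive_dcoord i F x : derivable F x (e_ i) -> is_derive x (e_ i) F (dcoord i F x).
Proof. by move=> dF; apply: DeriveDef. Qed.

Lemma mixed_rcons i r F : mixed (rcons r i) F = dcoord i (mixed r F).
Proof. by elim: r F => //= j r IH F; rewrite IH. Qed.

Lemma eq_dcoord A i F G : near_stable A -> (forall x, A x -> F x = G x) ->
  forall x, A x -> dcoord i F x = dcoord i G x.
Proof.
move=> nA FG x Ax; apply: near_eq_derive; near=> y; apply: FG.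
by near: y; exact: nA.
Unshelve. all: by end_near. Qed.

Lemma eq_smooth A r F G : near_stable A -> (forall x, A x -> F x = G x) ->
  smooth r A F -> smooth r A G.
Proof.
move=> nA; elim: r F G => //= i r IH F G FG [dF sF sF']; split.
- move=> x Ax; apply: near_eq_derivable (dF x Ax); near=> y; apply: FG.
  by near: y; exact: nA.
- by apply: IH sF; exact: eq_dcoord.
- exact: IH sF'.
Unshelve. all: by end_near. Qed.

(** Lets an explicit formula [F'] stand for [dcoord i F], with which it need agree on [A] only. *)
Lemma smooth_cons A i r F F' : near_stable A ->
  (forall x, A x -> is_derive x (e_ i) F (F' x)) ->
  smooth r A F' -> smooth r A F -> smooth (i :: r) A F.
Proof.
move=> nA dF sF' sF; split=> //.
  by move=> x /dF h; exact: ex_derive.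
apply: eq_smooth sF' => // x Ax.
by have h := dF _ Ax; rewrite /dcoord derive_val.
Qed.

Lemma smooth_cst A r (c : R) : near_stable A -> smooth r A (fun=> c).
Proof.
move=> nA; elim: r c => // i r IH c.
by apply: (@smooth_cons _ _ _ _ (fun=> 0)) => // x Ax; exact: is_derive_cst.
Qed.

Lemma is_derive_dcoordM i F G x : derivable F x (e_ i) -> derivable G x (e_ i) ->
  is_derive x (e_ i) (fun y => F y * G y) (F x * dcoord i G x + dcoord i F x * G x).
Proof.
move=> dF dG; have := is_deriveM (is_derive_dcoord dF) (is_derive_dcoord dG).
by rewrite [X in _ + X]mulrC.
Qed.

Lemma smoothD A r F G : near_stable A -> smooth r A F -> smooth r A G ->
  smooth r A (fun x => F x + G x).
Proof.
move=> nA; elim: r F G => // i r IH F G [dF sF' sF] [dG sG' sG].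
apply: (@smooth_cons _ _ _ _ (fun x => dcoord i F x + dcoord i G x)) => //.
- by move=> x Ax; apply: is_deriveD; apply: is_derive_dcoord; [exact: dF|exact: dG].
- exact: IH.
- exact: IH.
Qed.

Lemma smoothM A r F G : near_stable A -> smooth r A F -> smooth r A G ->
  smooth r A (fun x => F x * G x).
Proof.
move=> nA; elim: r F G => // i r IH F G [dF sF' sF] [dG sG' sG].
apply: (@smooth_cons _ _ _ _ (fun x => F x * dcoord i G x + dcoord i F x * G x)) => //.
- by move=> x Ax; apply: is_derive_dcoordM; [exact: dF|exact: dG].
- by apply: smoothD => //; exact: IH.
- exact: IH.
Qed.

Lemma smoothX A r F n : near_stable A -> smooth r A F -> smooth r A (fun x => F x ^+ n).
Proof.
move=> nA sF; elim: n => [|n IH].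
  by under [X in smooth _ _ X]funext do rewrite expr0; exact: smooth_cst.
by under [X in smooth _ _ X]funext do rewrite exprS; exact: smoothM.
Qed.

(** [F] is known to have a partial derivative, not to be differentiable, so the chain rule is
    applied along the coordinate line. *)
Lemma is_derive_comp_scalar (phi : R -> R) F i x c : is_derive (F x) 1 phi c ->
  derivable F x (e_ i) ->
  is_derive x (e_ i) (fun y => phi (F y)) (c * dcoord i F x).
Proof.
move=> dphi dF.
have e := upd_id x i.
have d1 : is_derive (x 0 i) 1 (fun s => F (upd x i s)) (dcoord i F x).
  apply: DeriveDef; first by apply/derivable_upd; rewrite e.
  by rewrite -derive_upd e.
have dphi' : is_derive (F (upd x i (x 0 i))) 1 phi c by rewrite e.
have d2 := is_derive1_comp dphi' d1.
apply: DeriveDef.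
  rewrite -{1}e; apply/(@derivable_upd _ _ (fun y => phi (F y))).
  exact: (@ex_derive _ _ _ _ _ _ _ d2).
rewrite -{1}e (@derive_upd _ _ (fun y => phi (F y))); exact: (@derive_val _ _ _ _ _ _ _ d2).
Qed.

Lemma smooth_expR A r F : near_stable A -> smooth r A F ->
  smooth r A (fun x => expR (F x)).
Proof.
move=> nA; elim: r F => // i r IH F [dF sF' sF].
apply: (@smooth_cons _ _ _ _ (fun x => expR (F x) * dcoord i F x)) => //.
- by move=> x Ax; apply: is_derive_comp_scalar; exact: dF.
- by apply: smoothM => //; exact: IH.
- exact: IH.
Qed.

Lemma is_derive_coord_const (g : R -> R) i j x : i != j ->
  is_derive x (e_ j) (fun y => g (y 0 i)) 0.
Proof.
move=> ij; rewrite -{1}(upd_id x j).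
have dc : is_derive (x 0 j) 1 (fun s => g ((upd x j s) 0 i)) 0.
  by under [X in is_derive _ _ X _]funext do rewrite updNE//; exact: is_derive_cst.
apply: DeriveDef.
  by apply/(@derivable_upd _ _ (fun y => g (y 0 i))); exact: (@ex_derive _ _ _ _ _ _ _ dc).
rewrite (@derive_upd _ _ (fun y => g (y 0 i))); exact: (@derive_val _ _ _ _ _ _ _ dc).
Qed.

Lemma smooth_coord A (g : R -> R) i r : near_stable A -> i \notin r ->
  smooth r A (fun x => g (x 0 i)).
Proof.
move=> nA; elim: r => // j r IH; rewrite inE negb_or => /andP[ij ir].
apply: (@smooth_cons _ _ _ _ (fun=> 0)) => //.
- by move=> x _; exact: is_derive_coord_const.
- exact: smooth_cst.
- exact: IH.
Qed.

Definition cmap (f : R -> R) x : rV := \row_i f (x 0 i).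

Lemma cmap_upd f x i t : cmap f (upd x i t) = upd (cmap f x) i (f t).
Proof. by apply/rowP => j; rewrite !mxE; case: eqP. Qed.

Lemma is_derive_cmap F (f : R -> R) (x : rV) i c : is_derive (x 0 i) 1 f c ->
  derivable F (cmap f x) (e_ i) ->
  is_derive x (e_ i) (fun y => F (cmap f y)) (c * dcoord i F (cmap f x)).
Proof.
move=> df dF.
have e := upd_id x i.
have ef : upd (cmap f x) i (f (x 0 i)) = cmap f x by rewrite -cmap_upd e.
have d1 : is_derive (f (x 0 i)) 1 (fun s => F (upd (cmap f x) i s)) (dcoord i F (cmap f x)).
  apply: DeriveDef; first by apply/derivable_upd; rewrite ef.
  by rewrite -derive_upd ef.
have d2 := is_derive1_comp d1 df.
have eqf : (fun s => F (cmap f (upd x i s))) =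
    (fun s => F (upd (cmap f x) i s)) \o f.
  by apply/funext => s /=; rewrite cmap_upd.
apply: DeriveDef.
  rewrite -{1}e; apply/(@derivable_upd _ _ (fun y => F (cmap f y))).
  by rewrite eqf; exact: (@ex_derive _ _ _ _ _ _ _ d2).
rewrite -{1}e (@derive_upd _ _ (fun y => F (cmap f y))) eqf mulrC.
exact: (@derive_val _ _ _ _ _ _ _ d2).
Qed.

(** Differentiating in [i] produces the factor [f' (x 0 i)], which is constant in the coordinates
    still to come because [r] has no repetition; thus only the first derivative of [f] occurs. *)
Lemma smooth_cmap A B r F (f f' : R -> R) : near_stable A -> uniq r ->
  (forall x, A x -> B (cmap f x)) ->
  (forall x i, A x -> is_derive (x 0 i) 1 f (f' (x 0 i))) ->
  smooth r B F -> smooth r A (fun x => F (cmap f x)).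
Proof.
move=> nA + AB df; elim: r F => // i r IH F /= /andP[ir ur] [dF sF' sF].
apply: (@smooth_cons _ _ _ _ (fun x => f' (x 0 i) * dcoord i F (cmap f x))) => //.
- by move=> x Ax; apply: is_derive_cmap; [exact: df|exact/dF/AB].
- by apply: smoothM => //; [exact: smooth_coord|exact: IH].
- exact: IH.
Qed.

Lemma has_partials_smooth k A F r : has_partials k A F -> (size r <= k)%N ->
  smooth r A F.
Proof.
elim: r k F => // i r IH [//|k] F hF /= rk; split.
- by move=> x Ax; exact: (hF [::]).
- apply: (IH k) => // s j x sk Ax.
  have := hF (rcons s i) j x; rewrite size_rcons ltnS => /(_ sk Ax).
  by rewrite /partial foldr_rcons.
- by apply: (IH k) => // s j x sk Ax; apply: hF => //; exact: ltnW.
Qed.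

Lemma smooth_sub A B r F : (forall x, A x -> B x) -> smooth r B F -> smooth r A F.
Proof.
move=> AB; elim: r F => // i r IH F [dF sF' sF]; split; [|exact: IH|exact: IH].
by move=> x /AB; exact: dF.
Qed.

(* Pointwise convergence of the mixed derivatives over all subsequences of [r],
   again for the sake of the Leibniz rule. *)
Fixpoint mixed_cvg r A (Fn : nat -> rV -> R) F : Prop :=
  if r is i :: r' then
    mixed_cvg r' A (fun n => dcoord i (Fn n)) (dcoord i F) /\ mixed_cvg r' A Fn F
  else forall x, A x -> (fun n => Fn n x) @ \oo --> F x.

Lemma conv_mixed r A Fn F : mixed_cvg r A Fn F ->
  forall x, A x -> (fun n => mixed r (Fn n) x) @ \oo --> mixed r F x.
Proof. by elim: r Fn F => //= i r IH Fn F [/IH h _]. Qed.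

(** The list [t] records the differentiations already made along a branch of [mixed_cvg]; the
    invariant [uniq (t ++ r)] keeps all lists met free of repetitions. *)
Lemma mixed_conv r t A Fn F : uniq (t ++ r) ->
  (forall s, uniq s -> forall x, A x ->
     (fun n => mixed s (Fn n) x) @ \oo --> mixed s F x) ->
  mixed_cvg r A (fun n => mixed t (Fn n)) (mixed t F).
Proof.
move=> + h; elim: r t => [|i r IH] t /= utr.
  by move=> x Ax; apply: h => //; rewrite cats0 in utr.
split.
  rewrite -mixed_rcons (_ : (fun n => _) = (fun n => mixed (rcons t i) (Fn n))).
    by apply: IH; rewrite cat_rcons.
  by apply/funext => n; rewrite mixed_rcons.
by apply: IH; move: utr; rewrite !cat_uniq /= negb_or => /and3P[-> /andP[_ ->] /andP[_ ->]].
Qed.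

Lemma eq_conv r A Fn F Gn G : near_stable A ->
  (\forall n \near \oo, forall x, A x -> Fn n x = Gn n x) ->
  (forall x, A x -> F x = G x) -> mixed_cvg r A Fn F -> mixed_cvg r A Gn G.
Proof.
move=> nA; elim: r Fn F Gn G => [|i r IH] Fn F Gn G /= FGn FG.
  move=> h x Ax; rewrite -FG//; apply: cvg_trans (h x Ax).
  apply: near_eq_cvg; near=> n.
  have e : forall x, A x -> Fn n x = Gn n x by near: n.
  exact: e.
move=> [h1 h2]; split; last exact: IH h2.
apply: IH h1; last exact: eq_dcoord.
by apply: filterS FGn => n FGn x Ax; exact: eq_dcoord Ax.
Unshelve. all: by end_near. Qed.

Lemma conv_cons i r A Fn F Fn' F' : near_stable A ->
  (\forall n \near \oo, forall x, A x -> is_derive x (e_ i) (Fn n) (Fn' n x)) ->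
  (forall x, A x -> is_derive x (e_ i) F (F' x)) ->
  mixed_cvg r A Fn' F' -> mixed_cvg r A Fn F -> mixed_cvg (i :: r) A Fn F.
Proof.
move=> nA dFn dF cF' cF; split => //.
apply: eq_conv cF' => //.
  apply: filterS dFn => n dFn x Ax; have h := dFn _ Ax.
  by rewrite /dcoord derive_val.
by move=> x Ax; have h := dF _ Ax; rewrite /dcoord derive_val.
Qed.

Lemma conv_cst r A (cn : nat -> R) (c : R) : near_stable A -> cn @ \oo --> c ->
  mixed_cvg r A (fun n _ => cn n) (fun=> c).
Proof.
move=> nA; elim: r cn c => [|i r IH] cn c h; first by move=> x _.
apply: (@conv_cons _ _ _ _ _ (fun _ _ => 0) (fun=> 0)) => //.
- by apply: nearW => n x _; exact: is_derive_cst.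
- by apply: IH; exact: cvg_cst.
- exact: IH.
Qed.

Lemma convD r A Fn F Gn G : near_stable A ->
  (\forall n \near \oo, smooth r A (Fn n)) -> smooth r A F ->
  (\forall n \near \oo, smooth r A (Gn n)) -> smooth r A G ->
  mixed_cvg r A Fn F -> mixed_cvg r A Gn G ->
  mixed_cvg r A (fun n x => Fn n x + Gn n x) (fun x => F x + G x).
Proof.
move=> nA; elim: r Fn F Gn G => [|i r IH] Fn F Gn G sFn sF sGn sG.
  by move=> cF cG x Ax; apply: cvgD; [exact: cF|exact: cG].
move=> [cF' cF] [cG' cG]; case: sF => dF sF' sF; case: sG => dG sG' sG.
apply: (@conv_cons _ _ _ _ _ (fun n x => dcoord i (Fn n) x + dcoord i (Gn n) x)
  (fun x => dcoord i F x + dcoord i G x)) => //.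
- near=> n => x Ax.
  have [dFn _ _] : smooth (i :: r) A (Fn n) by near: n.
  have [dGn _ _] : smooth (i :: r) A (Gn n) by near: n.
  by apply: is_deriveD; apply: is_derive_dcoord; [exact: dFn|exact: dGn].
- by move=> x Ax; apply: is_deriveD; apply: is_derive_dcoord; [exact: dF|exact: dG].
- apply: IH => //.
  + by apply: filterS sFn => n [].
  + by apply: filterS sGn => n [].
- apply: IH => //.
  + by apply: filterS sFn => n [].
  + by apply: filterS sGn => n [].
Unshelve. all: by end_near. Qed.

Lemma convM r A Fn F Gn G : near_stable A ->
  (\forall n \near \oo, smooth r A (Fn n)) -> smooth r A F ->
  (\forall n \near \oo, smooth r A (Gn n)) -> smooth r A G ->
  mixed_cvg r A Fn F -> mixed_cvg r A Gn G ->
  mixed_cvg r A (fun n x => Fn n x * Gn n x) (fun x => F x * G x).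
Proof.
move=> nA; elim: r Fn F Gn G => [|i r IH] Fn F Gn G sFn sF sGn sG.
  by move=> cF cG x Ax; apply: cvgM; [exact: cF|exact: cG].
move=> [cF' cF] [cG' cG]; case: sF => dF sF' sF; case: sG => dG sG' sG.
have sFn1 : \forall n \near \oo, smooth r A (dcoord i (Fn n)) by apply: filterS sFn => n [].
have sGn1 : \forall n \near \oo, smooth r A (dcoord i (Gn n)) by apply: filterS sGn => n [].
have sFn0 : \forall n \near \oo, smooth r A (Fn n) by apply: filterS sFn => n [].
have sGn0 : \forall n \near \oo, smooth r A (Gn n) by apply: filterS sGn => n [].
apply: (@conv_cons _ _ _ _ _
  (fun n x => Fn n x * dcoord i (Gn n) x + dcoord i (Fn n) x * Gn n x)
  (fun x => F x * dcoord i G x + dcoord i F x * G x)) => //.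
- near=> n => x Ax.
  have [dFn _ _] : smooth (i :: r) A (Fn n) by near: n.
  have [dGn _ _] : smooth (i :: r) A (Gn n) by near: n.
  by apply: is_derive_dcoordM; [exact: dFn|exact: dGn].
- by move=> x Ax; apply: is_derive_dcoordM; [exact: dF|exact: dG].
- apply: convD => //; [|by apply: smoothM| |by apply: smoothM|by apply: IH|by apply: IH].
  + near=> n; apply: smoothM => //; near: n => //.
  + near=> n; apply: smoothM => //; near: n => //.
- exact: IH.
Unshelve. all: by end_near. Qed.

End calculus.

(** * Powers converging to the exponential *)

Section limits.
Variable R : realType.

Lemma cvg_inv_nat : (fun n : nat => n%:R^-1 : R) @ \oo --> (0 : R).
Proof. by rewrite -cvg_shiftS; exact: cvg_harmonic. Qed.

Lemma cvg_natsub_ratio (m : nat) : (fun n : nat => (n - m)%:R / n%:R : R) @ \oo --> (1 : R).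
Proof.
have h : (fun n : nat => 1 - m%:R * n%:R^-1 : R) @ \oo --> (1 : R).
  rewrite -[X in _ --> X](subr0 (1 : R)); apply: cvgB; first exact: cvg_cst.
  rewrite -[X in _ --> X](mulr0 (m%:R : R)); apply: cvgMr.
  exact: cvg_inv_nat.
apply: cvg_trans h; apply: near_eq_cvg; near=> n.
have mn : (m <= n)%N by near: n; exact: nbhs_infty_ge.
have n0 : (0 < n)%N by near: n; exact: nbhs_infty_gt.
by rewrite natrB// mulrBl divff// pnatr_eq0 -lt0n.
Unshelve. all: by end_near. Qed.

Lemma is_derive_mull (c y : R) : is_derive y 1 (fun z => c * z) c.
Proof.
rewrite -[X in is_derive _ _ _ X]mulr1.
exact: (is_deriveZ c (is_derive_id y (1 : R))).
Qed.

(** The exponent is a truncated difference: when it is 0, so is the factor [(n - m)%:R], and the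
    formula holds for all [n] and [m]. *)
Lemma is_derive_pow_affine (n m : nat) (y : R) :
  is_derive y 1 (fun y => (1 + n%:R^-1 * y) ^+ (n - m))
    ((n - m)%:R / n%:R * (1 + n%:R^-1 * y) ^+ (n - m.+1)).
Proof.
have h : is_derive y 1 (fun z : R => 1 + n%:R^-1 * z) n%:R^-1.
  rewrite -[X in is_derive _ _ _ X]add0r.
  exact: (is_deriveD (is_derive_cst (1 : R) y (1 : R)) (is_derive_mull _ y)).
have h2 := is_deriveX (n - m) h.
rewrite exprfctE in h2; apply: (is_derive_eq h2).
rewrite subnS /GRing.scale/=; ring.
Qed.

(** This is [1 - z <= expR (- z)] at [z = y / (1 + y)], where [1 - z] is the inverse of [1 + y]. *)
Lemma expR_frac_le (y : R) : -1 < y -> expR (y / (1 + y)) <= 1 + y.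
Proof.
move=> y1; have y0 : 0 < 1 + y by lra.
rewrite -[expR _]invrK -expRN -[leRHS]invrK lef_pV2 ?posrE ?invr_gt0 ?expR_gt0//.
apply: le_trans (expR_ge1Dx _).
by rewrite le_eqVlt; apply/orP; left; apply/eqP; field; lra.
Qed.

(** With [y = cn n / n], the bounds [expR (y / (1 + y)) <= 1 + y <= expR y] are raised to the power
    [n - m]; both resulting exponents tend to [c]. *)
Lemma cvg_pow_expR (cn : nat -> R) (c : R) (m : nat) : cn @ \oo --> c ->
  (fun n : nat => (1 + n%:R^-1 * cn n) ^+ (n - m)) @ \oo --> expR c.
Proof.
move=> hc.
have hy : (fun n : nat => n%:R^-1 * cn n) @ \oo --> 0.
  by rewrite -[X in _ --> X](mul0r c); apply: cvgM => //; exact: cvg_inv_nat.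
have hk : (fun n : nat => (n - m)%:R / n%:R * cn n) @ \oo --> c.
  by rewrite -[X in _ --> X]mul1r; apply: cvgM => //; exact: cvg_natsub_ratio.
have hk' : (fun n : nat => (n - m)%:R / n%:R * cn n / (1 + n%:R^-1 * cn n)) @ \oo --> c.
  rewrite -[X in _ --> X]divr1; apply: cvgM => //; apply: cvgV; first exact: oner_neq0.
  by rewrite -[X in _ --> X](addr0 (1 : R)); apply: cvgD => //; exact: cvg_cst.
have cexp (u : nat -> R) : u @ \oo --> c -> (fun n => expR (u n)) @ \oo --> expR c.
  by move=> hu; apply: continuous_cvg => //; exact: continuous_expR.
apply: (squeeze_cvgr _ (cexp _ hk') (cexp _ hk)).
have hy1 : \forall n \near \oo, -1 < n%:R^-1 * cn n.
  by have := cvgr_gt _ hy; apply; lra.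
near=> n.
have y1 : -1 < n%:R^-1 * cn n by near: n.
rewrite -!mulrA !expRM_natl.
apply/andP; split.
  apply: lerXn2r; rewrite ?nnegrE ?expR_ge0//; first lra.
  by rewrite mulrA; exact: expR_frac_le.
apply: lerXn2r; rewrite ?nnegrE ?expR_ge0//; first lra.
exact: expR_ge1Dx.
Unshelve. all: by end_near. Qed.

End limits.

Section calculus_limits.
Variables (R : realType) (d : nat).
Local Notation rV := 'rV[R]_d.
Local Notation e_ i := (delta_mx 0 i : rV).
Implicit Types (x : rV) (i j : 'I_d) (r : seq 'I_d) (F G : rV -> R) (A B : set rV).

Lemma convX A r Fn F k : near_stable A ->
  (\forall n \near \oo, smooth r A (Fn n)) -> smooth r A F ->
  mixed_cvg r A Fn F -> mixed_cvg r A (fun n x => Fn n x ^+ k) (fun x => F x ^+ k).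
Proof.
move=> nA sFn sF cF; elim: k => [|k IH].
  apply: (@eq_conv _ _ _ _ (fun _ _ => 1) (fun=> 1)) => //.
    by apply: nearW => n x _; rewrite expr0.
  by apply: conv_cst => //; exact: cvg_cst.
apply: (@eq_conv _ _ _ _ (fun n x => Fn n x * Fn n x ^+ k) (fun x => F x * F x ^+ k)) => //.
- by apply: nearW => n x _; rewrite exprS.
- by move=> x _; rewrite exprS.
apply: convM => //; last exact: smoothX.
by apply: filterS sFn => n sFn; exact: smoothX.
Qed.

(** One differentiation yields (n - m)/n times the same kind of power with [m.+1] times a derivative
    of [cn n]; the induction therefore runs over all [m]. *)
Lemma conv_pow_expR r A (cn : nat -> rV -> R) (c : rV -> R) m : near_stable A ->
  (\forall n \near \oo, smooth r A (cn n)) -> smooth r A c -> mixed_cvg r A cn c ->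
  mixed_cvg r A (fun n x => (1 + n%:R^-1 * cn n x) ^+ (n - m)) (fun x => expR (c x)).
Proof.
move=> nA; elim: r cn c m => [|i r IH] cn c m scn sc.
  by move=> h x Ax; apply: cvg_pow_expR; exact: h.
move=> [hc' hc]; case: sc => dc sc' sc.
have scn1 : \forall n \near \oo, smooth r A (dcoord i (cn n)) by apply: filterS scn => n [].
have scn0 : \forall n \near \oo, smooth r A (cn n) by apply: filterS scn => n [].
have sp k : \forall n \near \oo,
    smooth r A (fun x => (1 + n%:R^-1 * cn n x) ^+ (n - k)).
  near=> n; apply: smoothX => //; apply: smoothD => //; first exact: smooth_cst.
  by apply: smoothM => //; [exact: smooth_cst|near: n].
(* The factor 1 in the limit is the limit of (n - m)/n, kept so that both sides are products of the
   same shape. *)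
apply: (@conv_cons _ _ _ _ _ _ _
  (fun n x => (n - m)%:R / n%:R * (1 + n%:R^-1 * cn n x) ^+ (n - m.+1) * dcoord i (cn n) x)
  (fun x => 1 * expR (c x) * dcoord i c x)) => //.
- near=> n => x Ax.
  have [dcn _ _] : smooth (i :: r) A (cn n) by near: n.
  apply: (@is_derive_comp_scalar _ _ (fun y => (1 + n%:R^-1 * y) ^+ (n - m))); last exact: dcn.
  exact: is_derive_pow_affine.
- by move=> x Ax; rewrite mul1r; apply: is_derive_comp_scalar; exact: dc.
- apply: convM => //.
  + near=> n; apply: smoothM => //; first exact: smooth_cst.
    by near: n; exact: sp.
  + by apply: smoothM => //; [exact: smooth_cst|exact: smooth_expR].
  + apply: convM => //.
    * by apply: nearW => n; exact: smooth_cst.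
    * exact: smooth_cst.
    * exact: smooth_expR.
    * by apply: conv_cst => //; exact: cvg_natsub_ratio.
    * exact: IH.
- exact: IH.
Unshelve. all: by end_near. Qed.

Lemma conv_coord A (gn : nat -> R -> R) (g : R -> R) i r : near_stable A -> i \notin r ->
  (forall x, A x -> (fun n => gn n (x 0 i)) @ \oo --> g (x 0 i)) ->
  mixed_cvg r A (fun n x => gn n (x 0 i)) (fun x => g (x 0 i)).
Proof.
move=> nA + h; elim: r => [|j r IH]; first by move=> _ x Ax; exact: h.
rewrite inE negb_or => /andP[ij ir].
apply: (@conv_cons _ _ _ _ _ _ _ (fun _ _ => 0) (fun=> 0)) => //.
- by apply: nearW => n x _; exact: is_derive_coord_const.
- by move=> x _; exact: is_derive_coord_const.
- by apply: conv_cst => //; exact: cvg_cst.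
- exact: IH.
Qed.

Lemma cvg_cmap (fn : nat -> R -> R) (f : R -> R) x :
  (forall i, (fun n => fn n (x 0 i)) @ \oo --> f (x 0 i)) ->
  (fun n => cmap (fn n) x) @ \oo --> cmap f x.
Proof.
move=> h U [V MV VU].
suff hV i : \forall n \near \oo, V 0 i ((cmap (fn n) x) 0 i).
  near=> n; apply: VU => k i; rewrite (ord1 k).
  by move: i; near: n; exact: filter_forall hV.
have hi : \forall n \near \oo, V 0 i (fn n (x 0 i)).
  by apply: h; have := MV 0 i; rewrite mxE.
by apply: filterS hi => n; rewrite mxE.
Unshelve. all: by end_near. Qed.

Lemma has_continuous_partials_dcoord k A F i : has_continuous_partials k.+1 A F ->
  has_continuous_partials k A (dcoord i F).
Proof.
move=> [h1 h2]; split.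
  move=> s j x sk Ax; have := h1 (rcons s i) j x.
  by rewrite size_rcons ltnS => /(_ sk Ax); rewrite /partial foldr_rcons.
move=> s x sk Ax; have := h2 (rcons s i) x.
by rewrite size_rcons ltnS => /(_ sk Ax); rewrite /partial foldr_rcons.
Qed.

Lemma has_continuous_partialsS k A F : has_continuous_partials k.+1 A F ->
  has_continuous_partials k A F.
Proof.
move=> [h1 h2]; split=> [s j x sk|s x sk] Ax; first by apply: h1 => //; exact: ltnW.
by apply: h2 => //; exact: leqW.
Qed.

(** Here [F] is fixed and the point of evaluation moves; the continuity of the partial derivatives
    of [F] enters at the end of the recursion, once all differentiations are done. *)
Lemma conv_cmap A B k r F (fn fn' : nat -> R -> R) (f f' : R -> R) :
  near_stable A -> uniq r -> (size r <= k)%N -> has_continuous_partials k B F ->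
  (\forall n \near \oo, forall x, A x -> B (cmap (fn n) x)) ->
  (forall x, A x -> B (cmap f x)) ->
  (\forall n \near \oo, forall x i, A x -> is_derive (x 0 i) 1 (fn n) (fn' n (x 0 i))) ->
  (forall x i, A x -> is_derive (x 0 i) 1 f (f' (x 0 i))) ->
  (forall x i, A x -> (fun n => fn n (x 0 i)) @ \oo --> f (x 0 i)) ->
  (forall x i, A x -> (fun n => fn' n (x 0 i)) @ \oo --> f' (x 0 i)) ->
  mixed_cvg r A (fun n x => F (cmap (fn n) x)) (fun x => F (cmap f x)).
Proof.
move=> nA + + + Bn B0 dfn df cfn cf; elim: r k F => [|i r IH] k F.
  move=> _ _ [_ cF] x Ax.
  have := cF [::] _ isT (B0 _ Ax); rewrite /= => cFx.
  apply: (cvg_comp (fun n => cmap (fn n) x) F _ cFx).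
  by apply: cvg_cmap => i; exact: cfn.
case: k => [//|k] /= /andP[ir ur] rk hF.
have hF' := has_continuous_partials_dcoord i hF.
have hF0 := has_continuous_partialsS hF.
have sm n : (forall x, A x -> B (cmap (fn n) x)) ->
    (forall x i, A x -> is_derive (x 0 i) 1 (fn n) (fn' n (x 0 i))) ->
    smooth r A (fun x => dcoord i F (cmap (fn n) x)).
  move=> h1 h2; apply: smooth_cmap h2 _ => //; first exact: h1.
  exact: has_partials_smooth (proj1 hF') rk.
apply: (@conv_cons _ _ _ _ _ _ _
  (fun n x => fn' n (x 0 i) * dcoord i F (cmap (fn n) x))
  (fun x => f' (x 0 i) * dcoord i F (cmap f x))) => //.
- near=> n => x Ax.
  have h1 : forall x, A x -> B (cmap (fn n) x) by near: n.
  have h2 : forall x i, A x -> is_derive (x 0 i) 1 (fn n) (fn' n (x 0 i)) by near: n.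
  by apply: is_derive_cmap; [exact: h2|apply: (proj1 hF [::]) => //; exact: h1].
- move=> x Ax.
  by apply: is_derive_cmap; [exact: df|apply: (proj1 hF [::]) => //; exact: B0].
- apply: convM => //.
  + by apply: nearW => n; exact: smooth_coord.
  + exact: smooth_coord.
  + by near=> n; apply: sm; near: n.
  + apply: smooth_cmap df _ => //; first exact: B0.
    exact: has_partials_smooth (proj1 hF') rk.
  + by apply: conv_coord => // x Ax; exact: cf.
  + exact: IH hF'.
- exact: IH hF0.
Unshelve. all: by end_near. Qed.

End calculus_limits.

(** * Total variation and changes of scale *)

Section laws.
Variables (R : realType) (d : nat).
Local Notation rV := 'rV[R]_d.
Local Notation brV := (borel_rV R d).
Implicit Types (P Q S : probability brV R) (x u v : rV) (i : 'I_d).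

Lemma push_subproof P (f : brV -> brV) (mf : measurable_fun setT f) :
  {Q : probability brV R | forall A, Q A = P (f @^-1` A)}.
Proof.
pose X : {mfun brV >-> brV} := HB.pack f (isMeasurableFun.Build _ _ _ _ f mf).
by exists (distribution P X).
Qed.

Definition push P f (mf : measurable_fun setT f) : probability brV R :=
  sval (push_subproof P mf).

Lemma pushE P f (mf : measurable_fun setT f) A : push P mf A = P (f @^-1` A).
Proof. by rewrite /push; case: push_subproof. Qed.

Lemma measurable_cmap (f : R -> R) : measurable_fun setT f ->
  measurable_fun setT (cmap f : brV -> brV).
Proof.
move=> mf; apply: measurable_rV => i.
rewrite (_ : (fun t : brV => _) = f \o (fun v : brV => (v : rV) 0 i)).
  exact: (measurableT_comp mf (measurable_coord i)).
by apply/funext => v /=; rewrite mxE.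
Qed.

(** One-sided: [tvle_sym] recovers the other inequality from complements, so this bounds the total
    variation distance by [e]. *)
Definition tvle P Q (e : R) :=
  forall A : set brV, measurable A -> (P A <= Q A + e%:E)%E.

Lemma tvle_sym P Q e : tvle P Q e -> tvle Q P e.
Proof.
move=> h A mA; have := h _ (measurableC mA).
rewrite !probability_setC//.
rewrite -(fineK (fin_num_measure P _ mA)) -(fineK (fin_num_measure Q _ mA)).
by rewrite -!EFinB -!EFinD !lee_fin; lra.
Qed.

Lemma tvle_trans P Q S e1 e2 : tvle P Q e1 -> tvle Q S e2 -> tvle P S (e1 + e2).
Proof.
move=> h1 h2 A mA; rewrite (le_trans (h1 _ mA))//.
by rewrite (le_trans (leeD2r _ (h2 _ mA)))// -addeA -EFinD (addrC e2).
Qed.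

Lemma tvle_push P Q f (mf : measurable_fun setT f) e : tvle P Q e ->
  tvle (push P mf) (push Q mf) e.
Proof.
move=> h A mA; rewrite !pushE; apply: h.
by rewrite -[X in measurable X]setTI; exact: mf.
Qed.

Lemma tvle_dist P Q e A : measurable A -> tvle P Q e -> (`|P A - Q A| <= e%:E)%E.
Proof.
move=> mA h; have := h _ mA; have := tvle_sym h mA.
rewrite -(fineK (fin_num_measure P _ mA)) -(fineK (fin_num_measure Q _ mA)).
rewrite -!EFinB -!EFinD !lee_fin => h1 h2.
by rewrite ler_norml; apply/andP; split; lra.
Qed.

Lemma probability_restrict P (E A : set brV) : measurable E -> P E = 1%E ->
  measurable A -> P A = P (A `&` E).
Proof.
move=> mE PE mA.
have PEc : P (A `\` E) = 0%E.
  apply/eqP; rewrite -measure_le0 -(subee (_ : 1%E \is a fin_num))// -{2}PE -probability_setC//.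
  apply: le_measure; rewrite ?inE; [exact: measurableD|exact: measurableC|].
  by move=> v [].
have mAE : measurable (A `&` E) by exact: measurableI.
have mAD : measurable (A `\` E) by exact: measurableD.
have dAE : (A `&` E) `&` (A `\` E) = set0 by rewrite setDE setIACA setICr setI0.
have := measureU P mAE mAD dAE; rewrite setUIDK => ->.
by rewrite -[RHS]adde0 -PEc.
Qed.

Lemma eq_probability P (E A B : set brV) : measurable E -> P E = 1%E ->
  measurable A -> measurable B -> A `&` E = B `&` E -> P A = P B.
Proof.
move=> mE PE mA mB AB.
by rewrite (probability_restrict mE PE mA) AB -probability_restrict.
Qed.

Lemma df_fin P x : (df P x)%:E = P (lower_set x).
Proof. by rewrite /df fineK// fin_num_measure//; exact: lower_set_measurable. Qed.

(** The faces with a zero coordinate are left out: there [ln] takes a default value and [expR] does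
    not invert it. *)
Definition unit_box : set rV := [set u | forall i, 0 < u 0 i <= 1].

Lemma unit_boxE : unit_box = halfbox 0 (const_mx 1).
Proof. by apply/seteqP; split=> v h i; have := h i; rewrite !mxE. Qed.

Lemma unit_box_measurable : measurable (unit_box : set brV).
Proof. by rewrite unit_boxE; exact: halfbox_measurable. Qed.

(** All the mass lies below the corner 1, and the part of it with some coordinate at most 0 is a
    finite union of null lower sets. *)
Lemma unit_box_full Q : df Q (const_mx 1) = 1 ->
  (forall i, df Q (upd (const_mx 1) i 0) = 0) -> Q unit_box = 1%E.
Proof.
move=> Q1 Q0.
have mU := unit_box_measurable.
have L1 : Q (lower_set (const_mx 1)) = 1%E by rewrite -df_fin Q1.
(* The finite union is written as a sequence, with empty sets for indices that are not below [d]. *)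
have F0 k : Q.-negligible (if insub k is Some i then lower_set (upd (const_mx 1) i 0)
                           else (set0 : set brV)).
  case: insubP => [i _ _|_]; last exact: negligible_set0.
  have QL : Q (lower_set (upd (const_mx 1) i 0)) = 0%E by rewrite -df_fin Q0.
  by apply/negligibleP; [exact: lower_set_measurable|exact: QL].
have [Z [mZ QZ FZ]] := negligible_bigcup F0.
apply/eqP; rewrite eq_le probability_le1//=.
rewrite -L1; apply: (@le_trans _ _ (Q (unit_box `|` Z))).
  apply: le_measure; rewrite ?inE; [exact: lower_set_measurable|exact: measurableU|].
  move=> v v1; have [vpos|/existsNP[i /negP vi]] := pselect (forall i, 0 < v 0 i).
    by left=> i; rewrite vpos/=; have := v1 i; rewrite mxE.
  right; apply: FZ; exists (val i) => //; rewrite valK => j.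
  by rewrite mxE; case: eqP => [->|_]; [rewrite leNgt|exact: v1].
by apply: (le_trans (measureU2 Q mU mZ)); rewrite -[leRHS]adde0 -QZ.
Qed.

End laws.
Arguments unit_box {R d}.

(** * Passage to logarithmic coordinates *)

Section log_law.
Variables (R : realType) (d : nat).
Local Notation rV := 'rV[R]_d.
Local Notation brV := (borel_rV R d).
Implicit Types (P Q S : probability brV R) (x u v : rV) (i : 'I_d).

Lemma measurable_cmap_ln : measurable_fun setT (cmap (@ln R) : brV -> brV).
Proof. by apply: measurable_cmap; exact: measurable_ln. Qed.

Lemma measurable_cmap_expR : measurable_fun setT (cmap (@expR R) : brV -> brV).
Proof. by apply: measurable_cmap; exact: measurable_expR. Qed.

Definition log_law Q : probability brV R := push Q measurable_cmap_ln.

Lemma preimage_measurable (f : brV -> brV) A : measurable_fun setT f ->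
  measurable A -> measurable (f @^-1` A).
Proof. by move=> mf mA; rewrite -[X in measurable X]setTI; exact: mf. Qed.

Lemma cmap_lnK u : (forall i, 0 < u 0 i) -> cmap expR (cmap (@ln R) u) = u.
Proof. by move=> u0; apply/rowP => i; rewrite !mxE lnK// posrE. Qed.

Lemma df_log_law Q x : Q unit_box = 1%E -> df (log_law Q) x = df Q (cmap expR x).
Proof.
move=> Q1; apply: EFin_inj; rewrite !df_fin /log_law pushE.
apply: (eq_probability (@unit_box_measurable R d) Q1).
- by apply: preimage_measurable; [exact: measurable_cmap_ln|exact: lower_set_measurable].
- exact: lower_set_measurable.
- have e v i : unit_box v -> (ln (v 0 i) <= x 0 i) = (v 0 i <= expR (x 0 i)).
    by move=> /(_ i) /andP[v0 _]; rewrite -ler_expR lnK.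
  by apply/seteqP; split=> v [h v1]; split => // i; have := h i; rewrite /= !mxE e.
Qed.

Lemma log_lawK Q A : Q unit_box = 1%E -> measurable A ->
  Q A = log_law Q (cmap expR @^-1` A).
Proof.
move=> Q1 mA; rewrite /log_law pushE.
apply: (eq_probability (@unit_box_measurable R d) Q1) => //.
- apply: preimage_measurable; first exact: measurable_cmap_ln.
  by apply: preimage_measurable => //; exact: measurable_cmap_expR.
- have e v : unit_box v -> cmap expR (cmap (@ln R) v) = v.
    by move=> v1; apply: cmap_lnK => i; have /andP[] := v1 i.
  by apply/seteqP; split=> v [h v1]; split => //=; move: h; rewrite /= e.
Qed.

Lemma neg_orthant_measurable : measurable (neg_orthant : set brV).
Proof.
have -> : neg_orthant = [set v : brV | forall i, ((fun v : brV => (v : rV) 0 i) @^-1` `]-oo, 0[) v].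
  by apply/seteqP; split=> v /= h i; have := h i; rewrite in_itv.
apply: forall_measurable => i; rewrite -[X in measurable X]setTI.
by apply: measurable_coord => //; exact: measurable_itv.
Qed.

(** The danger is mass on the faces where a coordinate equals 1, sent by the logarithm to the
    boundary of the orthant. Lower sets with corner [t < 1] avoid these faces. *)
Lemma log_law_neg_orthant Q : Q unit_box = 1%E ->
  (forall e : R, 0 < e -> exists2 t : R, t < 1 & 1 - e <= df Q (const_mx t)) ->
  log_law Q neg_orthant = 1%E.
Proof.
move=> Q1 h; apply/eqP; rewrite eq_le probability_le1//=; last exact: neg_orthant_measurable.
apply/lee_addgt0Pr => e e0; have [t t1 ht] := h _ e0.
apply: (@le_trans _ _ (Q (lower_set (const_mx t)) + e%:E)%E).
  by rewrite -df_fin -EFinD lee_fin; lra.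
rewrite leeD2r// (probability_restrict (@unit_box_measurable R d) Q1); last exact: lower_set_measurable.
rewrite /log_law pushE; apply: le_measure; rewrite ?inE.
- by apply: measurableI; [exact: lower_set_measurable|exact: unit_box_measurable].
- by apply: preimage_measurable; [exact: measurable_cmap_ln|exact: neg_orthant_measurable].
- move=> v [vt v1] i /=; rewrite mxE; apply: ln_lt0.
  have /andP[-> _] := v1 i; have := vt i; rewrite mxE => /le_lt_trans; exact.
Qed.

End log_law.

(** * The normalising maps [T_n] and [S_n] *)

Section root_maps.
Variables (R : realType) (d : nat).
Local Notation rV := 'rV[R]_d.
Local Notation brV := (borel_rV R d).
Implicit Types (P Q S : probability brV R) (x u v : rV) (i : 'I_d).

(* On the scale of [x = log u], the n-th root followed by the affine
   normalisation of extreme value theory is [rootT n], with inverse [powT n]. *)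
Definition rootT (n : nat) (t : R) : R := n%:R * (expR (n%:R^-1 * t) - 1).
Definition powT (n : nat) (t : R) : R := n%:R * ln (1 + n%:R^-1 * t).

Lemma rootTK n t : (0 < n)%N -> powT n (rootT n t) = t.
Proof.
move=> n0; have n0' : (n%:R : R) != 0 by rewrite pnatr_eq0 -lt0n.
rewrite /powT /rootT mulrA mulVf// mul1r (addrC 1) subrK expRK mulrA divff// mul1r//.
Qed.

Lemma rootT_gt n t : (0 < n)%N -> - n%:R < rootT n t.
Proof.
move=> n0; rewrite /rootT mulrBr mulr1 ltrBDl addrN.
by rewrite mulr_gt0 ?expR_gt0// ltr0n.
Qed.

Lemma rootT_lt0 n t : (0 < n)%N -> t < 0 -> rootT n t < 0.
Proof.
move=> n0 t0; rewrite /rootT pmulr_rlt0 ?ltr0n// subr_lt0 expR_lt1.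
by rewrite pmulr_rlt0// invr_gt0 ltr0n.
Qed.

Lemma rootT_ge n t : (0 < n)%N -> t <= rootT n t.
Proof.
move=> n0; have n0' : (0 : R) < n%:R by rewrite ltr0n.
by rewrite /rootT -ler_pdivrMl// lerBrDl; exact: expR_ge1Dx.
Qed.

Lemma rootT_lower n s t : (0 < n)%N -> 0 < 1 + n%:R^-1 * t ->
  (rootT n s <= t) = (s <= powT n t).
Proof.
move=> n0 t0; have n0' : (0 : R) < n%:R by rewrite ltr0n.
rewrite /rootT /powT -ler_pdivlMl// lerBlDl -[RHS]ler_pdivrMl//.
by rewrite -[RHS]ler_expR lnK.
Qed.

Lemma powT_lower n s t : (0 < n)%N -> 0 < 1 + n%:R^-1 * s ->
  (powT n s <= t) = (s <= rootT n t).
Proof.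
move=> n0 s0; have n0' : (0 : R) < n%:R by rewrite ltr0n.
rewrite /rootT /powT -ler_pdivlMl// -[RHS]ler_pdivrMl// lerBrDl.
by rewrite -[LHS]ler_expR lnK.
Qed.

Lemma measurable_rootT n : measurable_fun setT (rootT n).
Proof.
apply: measurable_funM => //; apply: measurable_funB => //.
by apply: (measurableT_comp (@measurable_expR R)); exact: measurable_funM.
Qed.

Lemma measurable_powT n : measurable_fun setT (powT n).
Proof.
apply: measurable_funM => //; apply: (measurableT_comp (@measurable_ln R)).
by apply: measurable_funD => //; exact: measurable_funM.
Qed.

Definition root_law n P : probability brV R := push P (measurable_cmap (measurable_rootT n)).
Definition pow_law n P : probability brV R := push P (measurable_cmap (measurable_powT n)).

Lemma root_lawK n P A : (0 < n)%N -> pow_law n (root_law n P) A = P A.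
Proof.
move=> n0; rewrite /pow_law /root_law !pushE; congr (P _).
apply/seteqP; split=> v /=; rewrite (_ : cmap _ (cmap _ v) = v)//;
  by apply/rowP => i; rewrite !mxE rootTK.
Qed.

Lemma df_root_law n P x : (0 < n)%N -> obox (- n%:R) 0 x ->
  df (root_law n P) x = df P (cmap (powT n) x).
Proof.
move=> n0 nx; apply: EFin_inj; rewrite !df_fin /root_law pushE; congr (P _).
have n0' : (0 : R) < n%:R by rewrite ltr0n.
have x0 i : 0 < 1 + n%:R^-1 * x 0 i.
  by have /andP[h _] := nx i; rewrite -ltrBlDl sub0r ltr_pdivlMl// mulrN1.
apply/seteqP; split=> v /= h i; have := h i; rewrite !mxE.
  by rewrite rootT_lower.
by rewrite rootT_lower.
Qed.

Lemma df_pow_root_law n k P x : (0 < k)%N -> (k <= n)%N ->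
  df (pow_law n (root_law k P)) x = df (root_law k P) (cmap (rootT n) x).
Proof.
move=> k0 kn; have n0 : (0 < n)%N by exact: leq_trans kn.
have n0' : (0 : R) < n%:R by rewrite ltr0n.
apply: EFin_inj; rewrite !df_fin /pow_law pushE /root_law pushE pushE; congr (P _).
(* Since [rootT k t] exceeds [- k], the condition [k <= n] keeps the argument of the logarithm in
   [powT n] positive. *)
have s0 (t : R) : 0 < 1 + n%:R^-1 * rootT k t.
  rewrite -ltrBlDl sub0r ltr_pdivlMl// mulrN1.
  by rewrite (le_lt_trans _ (rootT_gt t k0))// lerN2 ler_nat.
apply/seteqP; split=> v /= h i; have := h i; rewrite !mxE.
  by rewrite powT_lower.
by rewrite powT_lower.
Qed.

Lemma root_law_obox k P : (0 < k)%N -> P neg_orthant = 1%E ->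
  root_law k P (obox (- k%:R) 0) = 1%E.
Proof.
move=> k0 P1; apply/eqP; rewrite eq_le probability_le1//=; last exact: obox_measurable.
rewrite -P1 /root_law pushE; apply: le_measure; rewrite ?inE.
- exact: neg_orthant_measurable.
- apply: preimage_measurable; last exact: obox_measurable.
  exact: measurable_cmap (measurable_rootT k).
- by move=> v v0 i /=; rewrite mxE rootT_gt//= rootT_lt0.
Qed.

End root_maps.

(** * Extreme value copulas *)

Section copula_facts.
Variables (R : realType) (d : nat).
Local Notation rV := 'rV[R]_d.
Local Notation brV := (borel_rV R d).
Implicit Types (C D N : rV -> R) (x u v : rV) (i : 'I_d).

Lemma uniform_prob_le0 : uniform_prob (@ltr01 R) `]-oo, 0]%classic = 0%E.
Proof.
rewrite /uniform_prob integral_uniform_pdf.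
rewrite (_ : _ `&` _ = [set 0]); first by rewrite integral_set1.
apply/seteqP; split=> [t /=|t -> /=].
  by rewrite !in_itv/= => -[t0 /andP[t1 _]]; apply/eqP; rewrite eq_le t0 t1.
by rewrite !in_itv/= lexx ler01.
Qed.

Lemma copula_eq0 C v i : is_copula C -> v 0 i <= 0 -> C v = 0.
Proof.
move=> [disp [T [P [U [unif CE]]]]] vi.
pose H : set R := `]-oo, 0]%classic.
have P0 := unif i H (measurable_itv _).
rewrite uniform_prob_le0 in P0.
have mT (A : set brV) : measurable A -> measurable (U @^-1` A).
  by move=> mA; rewrite -[X in measurable X]setTI; apply: measurable_funPT.
have le0 : (P (U @^-1` lower_set v) <=
    P [set w | H ((U w : rV) 0%R i)])%E.
  apply: le_measure; rewrite ?inE.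
  - by apply: mT; exact: lower_set_measurable.
  - apply: (mT ((fun v : brV => (v : rV) 0 i) @^-1` `]-oo, 0]%classic)).
    by rewrite -[X in measurable X]setTI; apply: measurable_coord => //; exact: measurable_itv.
  - by move=> w /(_ i) h /=; rewrite /H/= in_itv/= (le_trans h).
apply: EFin_inj; rewrite CE df_fin; apply/eqP; rewrite -measure_le0.
by rewrite (le_trans le0)// P0.
Qed.

Lemma is_norm0 D : is_norm D -> D 0 = 0.
Proof. by move=> [_ h _]; rewrite -(scale0r (0 : rV)) h normr0 mul0r. Qed.

Lemma is_normN D x : is_norm D -> D (- x) = D x.
Proof. by move=> [_ h _]; rewrite -scaleN1r h normrN1 mul1r. Qed.

Lemma is_norm_ge0 D x : is_norm D -> 0 <= D x.
Proof.
move=> hD; have [_ _ h] := hD.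
have := h x (- x); rewrite subrr is_norm0// is_normN// => h2.
lra.
Qed.

Variables (C D N : rV -> R).
Hypotheses (hC : is_copula C) (hD : is_norm D) (hN : is_norm N).
Hypothesis h_i : forall eps : R, 0 < eps ->
     \forall u \near within closed_cube (nbhs (const_mx 1 : 'rV[R]_d)),
       `|C u - (1 - D (const_mx 1 - u))| <= eps * N (const_mx 1 - u).

(** The point 1 itself satisfies the estimate of (i), and there the error bound vanishes. *)
Lemma copula_one : C (const_mx 1) = 1.
Proof.
have := nbhs_singleton (h_i ltr01).
have cube1 : closed_cube (const_mx 1 : rV) by move=> i; rewrite mxE ler01 lexx.
move=> /(_ cube1); rewrite subrr !is_norm0// mulr0 subr0 normr_le0 subr_eq0.
by move/eqP.
Qed.

(** This is the order-zero analogue of (ii). It follows from (i) at 1 + x/n: both norms are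
    homogeneous, and their factor 1/n cancels the [n] in front. *)
Lemma cvg_copula_tail x : neg_orthant x ->
  (fun n : nat => n%:R * (C (const_mx 1 + n%:R^-1 *: x) - 1)) @ \oo --> - D x.
Proof.
move=> x0; apply/cvgrPdist_le => e e0.
have Nx0 := is_norm_ge0 x hN.
have e1 : 0 < e / (N x + 1) by rewrite divr_gt0//; lra.
have cu : (fun n : nat => const_mx 1 + n%:R^-1 *: x : rV) @ \oo --> (const_mx 1 : rV).
  rewrite -[X in _ --> X](addr0 (const_mx 1 : rV)) -(scale0r x).
  apply: cvgD; first exact: cvg_cst.
  by apply: cvgZr_tmp; exact: cvg_inv_nat.
have near1 := cu _ (h_i e1).
have [k kx] := rV_nat_bound (- x).
near=> n.
have n0 : (0 < n)%N by near: n; exact: nbhs_infty_gt.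
have n0' : (0 : R) < n%:R by rewrite ltr0n.
have : forall i, - n%:R <= x 0 i.
  have kn : (k <= n)%N by near: n; exact: nbhs_infty_ge.
  by move=> i; rewrite lerNl; have := kx i; rewrite mxE => /le_trans; apply; rewrite ler_nat.
move=> xn.
have un : closed_cube (const_mx 1 + n%:R^-1 *: x : rV).
  move=> i; rewrite !mxE.
  have h1 : n%:R^-1 * x 0 i <= 0 by rewrite pmulr_rle0 ?invr_gt0// ltW.
  have h2 : -1 <= n%:R^-1 * x 0 i by rewrite ler_pdivlMl// mulrN1.
  by apply/andP; split; lra.
have : `|C (const_mx 1 + n%:R^-1 *: x) - (1 - D (const_mx 1 - (const_mx 1 + n%:R^-1 *: x)))|
    <= e / (N x + 1) * N (const_mx 1 - (const_mx 1 + n%:R^-1 *: x)).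
  by move: un; near: n.
have -> : const_mx 1 - (const_mx 1 + n%:R^-1 *: x) = - (n%:R^-1 *: x).
  by rewrite opprD addrA subrr add0r.
rewrite !is_normN//.
have [_ hD2 _] := hD; have [_ hN2 _] := hN.
have ninv0 : (0 : R) <= n%:R^-1 by rewrite invr_ge0.
rewrite hD2 hN2 (ger0_norm ninv0) => h.
rewrite distrC opprK.
have -> : n%:R * (C (const_mx 1 + n%:R^-1 *: x) - 1) + D x =
    n%:R * (C (const_mx 1 + n%:R^-1 *: x) - (1 - n%:R^-1 * D x)).
  by field; rewrite gt_eqF.
rewrite normrM (ger0_norm (ltW n0')) -ler_pdivlMl// (le_trans h)//.
rewrite mulrCA ler_pM2l ?invr_gt0// mulrAC ler_pdivrMr; last lra.
by rewrite ler_pM2l//; lra.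
Unshelve. all: by end_near. Qed.

(** Dividing the convergent tail by [m] shows that C tends to 1 along the points with all
    coordinates 1 - 1/m; one of them is written as exp(-s). *)
Lemma copula_diag (n : nat) (e : R) : 0 < e ->
  exists2 s : R, 0 < s & 1 - e <= C (const_mx (expR (- s))) ^+ n.
Proof.
move=> e0.
pose w : rV := const_mx (-1).
have w0 : neg_orthant w by move=> i; rewrite mxE oppr_lt0.
have c1 : (fun m : nat => C (const_mx 1 + m%:R^-1 *: w)) @ \oo --> (1 : R).
  have h : (fun m : nat => 1 + m%:R^-1 * (m%:R * (C (const_mx 1 + m%:R^-1 *: w) - 1))) @ \oo
      --> (1 + 0 * - D w : R).
    apply: cvgD; first exact: cvg_cst.
    by apply: cvgM; [exact: cvg_inv_nat|exact: cvg_copula_tail].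
  rewrite mul0r addr0 in h; apply: cvg_trans h; apply: near_eq_cvg; near=> m.
  have m0 : (m%:R : R) != 0 by rewrite pnatr_eq0 -lt0n; near: m; exact: nbhs_infty_gt.
  by rewrite mulrA mulVf// mul1r addrC subrK.
have cn : (fun m : nat => C (const_mx 1 + m%:R^-1 *: w) ^+ n) @ \oo --> (1 : R).
  rewrite -[X in _ --> X](expr1n _ n); elim: n => [|k IH].
    exact: cvg_cst.
  rewrite exprS (_ : (fun m => _) = (fun m : nat => C (const_mx 1 + m%:R^-1 *: w) *
    C (const_mx 1 + m%:R^-1 *: w) ^+ k)); first exact: cvgM.
  by apply/funext => m; rewrite exprS.
have e1 : 1 - e < (1 : R) by lra.
have [M _ hM] : \forall m \near \oo, 1 - e < C (const_mx 1 + m%:R^-1 *: w) ^+ n :=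
  cvgr_gt _ cn _ e1.
(* With [m] at least 2, 1 - 1/m is positive and has a logarithm. *)
pose m := maxn M 2.
have /ltW he := hM m (leq_maxl _ _).
have m2 : (1 < m)%N by exact: leq_maxr.
have m1 : (m%:R^-1 : R) < 1 by rewrite invf_lt1 ?ltr1n// ltr0n (ltn_trans _ m2).
have m0 : (0 : R) < m%:R^-1 by rewrite invr_gt0 ltr0n (ltn_trans _ m2).
exists (- ln (1 - m%:R^-1)).
  by rewrite oppr_gt0; apply: ln_lt0; apply/andP; split; lra.
rewrite opprK lnK ?posrE ?subr_gt0//.
suff -> : const_mx (1 - m%:R^-1) = const_mx 1 + m%:R^-1 *: w by [].
by apply/rowP => i; rewrite !mxE mulrN1.
Unshelve. all: by end_near. Qed.

End copula_facts.

(** * Convergence to the extreme value law *)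

Section extreme_value.
Variables (R : realType) (d : nat).
Local Notation rV := 'rV[R]_d.
Local Notation brV := (borel_rV R d).
Implicit Types (x u v : rV) (i : 'I_d).
Variables (C D N : rV -> R).
Hypotheses (hD : is_norm D) (hD_partials : has_partials d neg_orthant D).
Hypotheses (hC : is_copula C) (hC_partials : has_continuous_partials d open_cube C).
Hypothesis (hN : is_norm N).
Hypothesis h_i : forall eps : R, 0 < eps ->
     \forall u \near within closed_cube (nbhs (const_mx 1 : 'rV[R]_d)),
       `|C u - (1 - D (const_mx 1 - u))| <= eps * N (const_mx 1 - u).
Hypothesis h_ii : forall s : seq 'I_d, s <> [::] -> uniq s ->
     forall x : 'rV[R]_d, neg_orthant x ->
       (fun n : nat =>
          partial s (fun y => n%:R * (C (const_mx 1 + n%:R^-1 *: y) - 1)) x)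
         @ \oo --> partial s (fun y => - D y) x.
Variables (Cn : nat -> probability brV R) (CG : probability brV R).
Hypothesis hCn : forall n : nat, (0 < n)%N ->
     forall u, closed_cube u -> df (Cn n) u = copula_power C n u.
Hypothesis hCG : forall u, closed_cube u -> df CG u = evc D u.

Lemma near_stable_obox (a b : R) : near_stable (obox a b : set rV).
Proof. by move=> x; exact: near_obox. Qed.

Lemma closed_cube_const1 : closed_cube (const_mx 1 : rV).
Proof. by move=> i; rewrite mxE ler01 lexx. Qed.

Lemma closed_cube_upd0 i : closed_cube (upd (const_mx 1) i 0 : rV).
Proof. by move=> j; rewrite !mxE; case: eqP => _; rewrite ?lexx ?ler01. Qed.

Lemma closed_cube_expR x : (forall i, x 0 i <= 0) -> closed_cube (cmap expR x).
Proof. by move=> x0 i; rewrite mxE expR_ge0 expR_le1 x0. Qed.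

Lemma evc_expR x : evc D (cmap expR x) = expR (- D x).
Proof.
rewrite /evc ifF.
  by congr (expR (- D _)); apply/rowP => i; rewrite !mxE expRK.
by apply/negbTE/existsPn => i; rewrite mxE expR_eq0.
Qed.

Lemma cmap_expR0 : cmap expR (0 : rV) = const_mx 1.
Proof. by apply/rowP => i; rewrite !mxE expR0. Qed.

Lemma copula_power_expR n x : copula_power C n (cmap expR x) =
  C (cmap (fun t => expR (n%:R^-1 * t)) x) ^+ n.
Proof.
rewrite /copula_power; congr (C _ ^+ n); apply/rowP => i; rewrite !mxE.
by rewrite -expRM mulrC.
Qed.

Lemma CG_unit_box : CG unit_box = 1%E.
Proof.
apply: unit_box_full => [|i].
  rewrite hCG; last exact: closed_cube_const1.
  by rewrite -cmap_expR0 evc_expR is_norm0// oppr0 expR0.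
rewrite hCG; last exact: closed_cube_upd0.
by rewrite /evc ifT//; apply/existsP; exists i; rewrite updE.
Qed.

Lemma Cn_unit_box n : (0 < n)%N -> Cn n unit_box = 1%E.
Proof.
move=> n0; apply: unit_box_full => [|i].
  rewrite hCn//; last exact: closed_cube_const1.
  rewrite -cmap_expR0 copula_power_expR.
  rewrite (_ : cmap _ _ = const_mx 1) ?(copula_one hD hN h_i) ?expr1n//.
  by apply/rowP => i; rewrite !mxE mulr0 expR0.
rewrite hCn//; last exact: closed_cube_upd0.
rewrite /copula_power (@copula_eq0 _ _ _ _ i)// ?expr0n ?gtn_eqF//.
by rewrite !mxE eqxx powR0// invr_neq0// pnatr_eq0 -lt0n.
Qed.

Lemma log_law_CG_neg_orthant : log_law CG neg_orthant = 1%E.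
Proof.
apply: log_law_neg_orthant; first exact: CG_unit_box.
move=> e e0; have D1 := is_norm_ge0 (const_mx 1) hD.
(* This choice gives exp(-s D(1)) >= 1 - s D(1) >= 1 - e. *)
have s0 : 0 < e / (D (const_mx 1) + 1) by rewrite divr_gt0//; lra.
set s := e / _ in s0.
have ce : const_mx (expR (- s)) = cmap expR (- s *: const_mx 1) :> rV.
  by apply/rowP => i; rewrite !mxE mulr1.
exists (expR (- s)); first by rewrite expR_lt1 oppr_lt0.
rewrite hCG ce; last first.
  by apply: closed_cube_expR => i; rewrite !mxE mulr1 oppr_le0 ltW.
rewrite evc_expR; have [_ hD2 _] := hD; rewrite hD2 normrN gtr0_norm//.
apply: le_trans (expR_ge1Dx _); rewrite lerD2l lerN2 /s.
by rewrite mulrAC ler_pdivrMr ?ler_pM2l//; lra.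
Qed.

Lemma log_law_Cn_neg_orthant n : (0 < n)%N -> log_law (Cn n) neg_orthant = 1%E.
Proof.
move=> n0; have n0' : (0 : R) < n%:R by rewrite ltr0n.
apply: log_law_neg_orthant; first exact: Cn_unit_box.
move=> e e0; have [s s0 hs] := copula_diag hD hN h_i n e0.
have ce : const_mx (expR (- (n%:R * s))) = cmap expR (const_mx (- (n%:R * s))) :> rV.
  by apply/rowP => i; rewrite !mxE.
have ns0 : 0 < n%:R * s by rewrite mulr_gt0.
(* The n-th root in C^(n) turns exp(-ns) into the exp(-s) supplied by [copula_diag]. *)
exists (expR (- (n%:R * s))); first by rewrite expR_lt1 oppr_lt0.
rewrite ce hCn//; last by apply: closed_cube_expR => i; rewrite mxE oppr_le0 ltW.
rewrite copula_power_expR (le_trans hs)//.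
suff -> : cmap (fun t => expR (n%:R^-1 * t)) (const_mx (- (n%:R * s))) =
   const_mx (expR (- s)) :> rV by [].
by apply/rowP => i; rewrite !mxE mulrN mulrA mulVf ?mul1r// gt_eqF.
Qed.

Lemma df_log_law_CG x : neg_orthant x -> df (log_law CG) x = expR (- D x).
Proof.
move=> x0; rewrite df_log_law ?CG_unit_box// hCG ?evc_expR//.
by apply: closed_cube_expR => i; exact/ltW.
Qed.

(** The law mu_n of the overview, carried by the cube of side ]-n, 0[ when [n] is positive. *)
Definition root_copula_law n := root_law n (log_law (Cn n)).

Definition affine1 (n : nat) (t : R) : R := 1 + n%:R^-1 * t.

Lemma obox_affine1 n x : (0 < n)%N -> obox (- n%:R) 0 x ->
  open_cube (cmap (affine1 n) x).
Proof.
move=> n0 nx i; have /andP[h1 h2] := nx i; have n0' : (0 : R) < n%:R by rewrite ltr0n.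
rewrite mxE /affine1 -ltrBlDl sub0r ltr_pdivlMl// mulrN1 h1/=.
by rewrite gtrDl pmulr_rlt0// invr_gt0.
Qed.

Lemma df_root_copula_law n x : (0 < n)%N -> obox (- n%:R) 0 x ->
  df (root_copula_law n) x = C (cmap (affine1 n) x) ^+ n.
Proof.
move=> n0 nx; have n0' : (0 : R) < n%:R by rewrite ltr0n.
have cube := obox_affine1 n0 nx.
rewrite /root_copula_law df_root_law//.
have lx i : powT n (x 0 i) < 0.
  by rewrite /powT pmulr_rlt0// ln_lt0//; have := cube i; rewrite mxE.
rewrite df_log_law ?Cn_unit_box// hCn//; last first.
  by apply: closed_cube_expR => i; rewrite mxE ltW.
rewrite copula_power_expR; congr (C _ ^+ n); apply/rowP => i; rewrite !mxE.
rewrite /powT mulrA mulVf ?gt_eqF// mul1r lnK// posrE.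
by have /andP[+ _] := cube i; rewrite mxE.
Qed.

Let tail n : rV -> R := fun y => n%:R * (C (const_mx 1 + n%:R^-1 *: y) - 1).

Lemma tail_affine1 n x : (0 < n)%N -> 1 + n%:R^-1 * tail n x = C (cmap (affine1 n) x).
Proof.
move=> n0; have n0' : (n%:R : R) != 0 by rewrite pnatr_eq0 -lt0n.
rewrite /tail mulrA mulVf// mul1r addrC subrK; congr (C _).
by apply/rowP => i; rewrite !mxE.
Qed.

Lemma is_derive_affine1 n (t : R) : is_derive t 1 (affine1 n) n%:R^-1.
Proof.
have h1 := is_derive_mull (n%:R^-1) t.
rewrite -[X in is_derive _ _ _ X]add0r.
exact: (is_deriveD (is_derive_cst (1 : R) t (1 : R)) h1).
Qed.

Lemma size_uniq_ord (r : seq 'I_d) : uniq r -> (size r <= d)%N.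
Proof. by move=> /card_uniqP <-; rewrite -[X in (_ <= X)%N](card_ord d) max_card. Qed.

Lemma smooth_affine1 n r : (0 < n)%N -> uniq r ->
  smooth r (obox (- n%:R) 0) (fun x => C (cmap (affine1 n) x)).
Proof.
move=> n0 ur.
apply: (@smooth_cmap _ _ _ open_cube _ _ _ (fun=> n%:R^-1)) => //.
- exact: near_stable_obox.
- by move=> x; exact: obox_affine1.
- by move=> x i _; exact: is_derive_affine1.
- by apply: (has_partials_smooth (proj1 hC_partials)); exact: size_uniq_ord.
Qed.

Lemma obox_sub (a b c : R) x : c <= a -> obox a b x -> obox c b x.
Proof. by move=> ca ax i; have /andP[h1 ->] := ax i; rewrite (le_lt_trans ca). Qed.

Lemma smooth_root_copula_law n r : (0 < n)%N -> uniq r ->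
  smooth r (obox (- n%:R) 0) (df (root_copula_law n)).
Proof.
move=> n0 ur; apply: (@eq_smooth _ _ _ _ (fun x => C (cmap (affine1 n) x) ^+ n)).
- exact: near_stable_obox.
- by move=> x nx; rewrite df_root_copula_law.
- by apply: smoothX; [exact: near_stable_obox|exact: smooth_affine1].
Qed.

Lemma smoothN_D r (a : R) : uniq r -> smooth r (obox a 0) (fun y => - D y).
Proof.
move=> ur; apply: (@eq_smooth _ _ _ _ (fun y => -1 * D y)).
- exact: near_stable_obox.
- by move=> x _; rewrite mulN1r.
apply: smoothM; first exact: near_stable_obox.
  by apply: smooth_cst; exact: near_stable_obox.
apply: (@smooth_sub _ _ _ neg_orthant).
  by move=> x ax i; have /andP[] := ax i.
by apply: (has_partials_smooth hD_partials); exact: size_uniq_ord.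
Qed.

(** On a cube carrying almost all of the limit law, and for [n] large enough for the cube of mu_n to
    contain it, the distribution function is (1 + tail/n)^n; so its mixed derivatives converge as
    soon as those of the tail do. *)
Lemma root_copula_law_cvg (e : R) : 0 < e ->
  \forall n \near \oo, tvle (log_law CG) (root_copula_law n) (3 * e).
Proof.
move=> e0; have [a a0 Pa] := neg_orthant_obox log_law_CG_neg_orthant e0.
pose r := enum 'I_d.
have ur : uniq r by exact: enum_uniq.
have rT i : i \in r by rewrite mem_enum.
have nA : near_stable (obox a 0 : set rV) by exact: near_stable_obox.
have [k ak] : exists k : nat, - k%:R <= a.
  exists (Num.truncn (- a)).+1; rewrite lerNl ltW// truncnS_gt//.
have large : \forall n \near \oo, (0 < n)%N /\ - n%:R <= a :> R.
  near=> n; split; first by near: n; exact: nbhs_infty_gt.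
  rewrite (le_trans _ ak)// lerN2 ler_nat; near: n; exact: nbhs_infty_ge.
have aneg x : obox a 0 x -> neg_orthant x by move=> ax i; have /andP[] := ax i.
have sD : smooth r (obox a 0) (fun y => - D y) by exact: smoothN_D.
apply: (@scheffe_density _ _ _ _ r a 0 e) => //.
- apply: filterS large => n [n0 na].
  apply: (@smooth_sub _ _ _ (obox (- n%:R) 0)); first by move=> x; exact: obox_sub.
  exact: smooth_root_copula_law.
- apply: (@eq_smooth _ _ _ _ (fun x => expR (- D x))) => //.
    by move=> x /aneg x0; rewrite df_log_law_CG.
  exact: smooth_expR.
apply: conv_mixed.
(* The exponent [n - 0] is the case [m = 0] of [conv_pow_expR]. *)
apply: (@eq_conv _ _ _ _ (fun n x => (1 + n%:R^-1 * tail n x) ^+ (n - 0))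
  (fun x => expR (- D x))) => //.
- apply: filterS large => n [n0 na] x ax.
  by rewrite subn0 tail_affine1// df_root_copula_law//; exact: obox_sub ax.
- by move=> x /aneg x0; rewrite df_log_law_CG.
apply: conv_pow_expR => //.
- apply: filterS large => n [n0 na].
  apply: (@eq_smooth _ _ _ _ (fun x => n%:R * (C (cmap (affine1 n) x) - 1))) => //.
    by move=> x _; rewrite -tail_affine1// addrC addKr mulrA divff ?mul1r// pnatr_eq0 -lt0n.
  apply: smoothM => //; first exact: smooth_cst.
  apply: smoothD => //; last exact: smooth_cst.
  apply: (@smooth_sub _ _ _ (obox (- n%:R) 0)); first by move=> x; exact: obox_sub.
  exact: smooth_affine1.
apply: (@mixed_conv _ _ r [::] (obox a 0) tail (fun y => - D y)) => //.
move=> s us x /aneg x0; case: s us => [|i s] us.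
  exact: (cvg_copula_tail hD hN h_i).
(* The list is reversed because [mixed] and [partial] differentiate in opposite orders; (ii) covers
   every ordering of the indices. *)
have snil : rev (i :: s) <> [::] by rewrite rev_cons; case: (rev s).
have us' : uniq (rev (i :: s)) by rewrite rev_uniq.
have h := h_ii snil us' x0; rewrite partial_rev in h.
apply: cvg_trans h; apply: near_eq_cvg; apply: nearW => n.
by rewrite partial_rev.
Unshelve. all: by end_near. Qed.

Lemma is_derive_rootT n (t : R) : (0 < n)%N ->
  is_derive t 1 (@rootT R n) (expR (n%:R^-1 * t)).
Proof.
move=> n0; have n0' : (n%:R : R) != 0 by rewrite pnatr_eq0 -lt0n.
have h1 := is_derive_mull (n%:R^-1) t.
have h2 := is_derive1_comp (is_derive_expR (n%:R^-1 * t)) h1.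
have h3 := is_deriveB h2 (is_derive_cst (1 : R) t (1 : R)).
have h4 := is_deriveZ (n%:R : R) h3.
apply: (is_derive_eq h4).
by rewrite subr0 /GRing.scale/= mulrCA mulfV// mulr1.
Qed.

(** Squeezed between [t] and t exp(t/n); the upper bound is 1 - y <= exp(-y) at y = t/n, multiplied
    by exp(y). *)
Lemma cvg_rootT (t : R) : (fun n => rootT n t) @ \oo --> t.
Proof.
have h0 : (fun n : nat => n%:R^-1 * t) @ \oo --> 0.
  rewrite -[X in _ --> X](mul0r t); apply: cvgMl; exact: cvg_inv_nat.
have h1 : (fun n : nat => t * expR (n%:R^-1 * t)) @ \oo --> t * expR 0.
  by apply: cvgMr; apply: continuous_cvg; [exact: continuous_expR|exact: h0].
rewrite expR0 mulr1 in h1.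
apply: (squeeze_cvgr _ (cvg_cst t) h1); near=> n.
have n0 : (0 < n)%N by near: n; exact: nbhs_infty_gt.
have n0' : (0 : R) < n%:R by rewrite ltr0n.
rewrite rootT_ge//= /rootT -ler_pdivlMl// mulrA.
have := expR_ge1Dx (- (n%:R^-1 * t)).
rewrite expRN => h.
have E0 := expR_gt0 (n%:R^-1 * t).
have : (1 - n%:R^-1 * t) * expR (n%:R^-1 * t) <= 1 by rewrite -ler_pdivlMr// div1r.
by rewrite mulrBl mul1r; lra.
Unshelve. all: by end_near. Qed.

(** For n >= k the transported law has on the cube of side ]-k, 0[ the distribution function C(1 +
    T_n x / k)^k, and T_n x tends to x with derivative tending to 1. That cube carries all of
    mu_k. *)
Lemma root_copula_law_rescale (k : nat) (e : R) : (0 < k)%N -> 0 < e ->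
  \forall n \near \oo, tvle (root_copula_law k) (pow_law n (root_copula_law k)) (3 * e).
Proof.
move=> k0 e0; pose r := enum 'I_d.
have ur : uniq r by exact: enum_uniq.
have rT i : i \in r by rewrite mem_enum.
pose A : set rV := obox (- k%:R) 0.
have nA : near_stable A by exact: near_stable_obox.
have k0' : - k%:R < 0 :> R by rewrite oppr_lt0 ltr0n.
have large : \forall n \near \oo, (k <= n)%N by exact: nbhs_infty_ge.
have n_gt0 n : (k <= n)%N -> (0 < n)%N by exact: leq_trans.
pose f n (t : R) := affine1 k (rootT n t).
(* The cube is stable because t <= T_n t < 0 for negative t. *)
have rootA n x : (0 < n)%N -> A x -> A (cmap (rootT n) x).
  move=> n0 Ax i; have /andP[h1 h2] := Ax i; rewrite mxE rootT_lt0// andbT.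
  by rewrite (lt_le_trans h1)// rootT_ge.
have fE n x : cmap (f n) x = cmap (affine1 k) (cmap (rootT n) x).
  by apply/rowP => i; rewrite !mxE.
have Bf n x : (0 < n)%N -> A x -> open_cube (cmap (f n) x).
  by move=> n0 Ax; rewrite fE; apply: obox_affine1 => //; exact: rootA.
have df_f n (t : R) : (0 < n)%N -> is_derive t 1 (f n) (k%:R^-1 * expR (n%:R^-1 * t)).
  by move=> n0; exact: (is_derive1_comp (is_derive_affine1 k (rootT n t)) (is_derive_rootT t n0)).
have sC : has_partials d open_cube C := proj1 hC_partials.
have sf n : (0 < n)%N -> smooth r A (fun x => C (cmap (f n) x)).
  move=> n0; apply: (@smooth_cmap _ _ _ open_cube _ _ _ (fun t => k%:R^-1 * expR (n%:R^-1 * t))) => //.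
  - by move=> x Ax; exact: Bf.
  - by move=> x i _; exact: df_f.
  - by apply: (has_partials_smooth sC); exact: size_uniq_ord.
have dfE n x : (k <= n)%N -> A x ->
    df (pow_law n (root_copula_law k)) x = C (cmap (f n) x) ^+ k.
  move=> kn Ax; rewrite df_pow_root_law// df_root_copula_law ?fE//.
  by apply: rootA => //; exact: n_gt0.
apply: (@scheffe_density _ _ _ _ r (- k%:R) 0 e) => //.
- rewrite root_law_obox//; last exact: log_law_Cn_neg_orthant.
  by rewrite -EFinB lee_fin lerBlDr lerDl ltW.
- apply: filterS large => n kn.
  apply: (@eq_smooth _ _ _ _ (fun x => C (cmap (f n) x) ^+ k)) => //.
    by move=> x Ax; rewrite dfE.
  by apply: smoothX => //; apply: sf; exact: n_gt0.
- exact: smooth_root_copula_law.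
apply: conv_mixed.
apply: (@eq_conv _ _ _ _ (fun n x => C (cmap (f n) x) ^+ k)
  (fun x => C (cmap (affine1 k) x) ^+ k)) => //.
- by apply: filterS large => n kn x Ax; rewrite dfE.
- by move=> x Ax; rewrite df_root_copula_law.
apply: convX => //.
- by apply: filterS large => n kn; apply: sf; exact: n_gt0.
- exact: smooth_affine1.
apply: (@conv_cmap _ _ _ open_cube d r C f (fun n t => k%:R^-1 * expR (n%:R^-1 * t))
  (affine1 k) (fun=> k%:R^-1)) => //.
- exact: size_uniq_ord.
- by apply: filterS large => n kn x Ax; apply: Bf => //; exact: n_gt0.
- by move=> x Ax; exact: obox_affine1.
- by apply: filterS large => n kn x i Ax; apply: df_f; exact: n_gt0.
- by move=> x i _; exact: is_derive_affine1.
- move=> x i Ax; apply: cvgD; first exact: cvg_cst.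
  by apply: cvgMr; exact: cvg_rootT.
- move=> x i Ax.
  have h : (fun n : nat => k%:R^-1 * expR (n%:R^-1 * x 0 i)) @ \oo --> k%:R^-1 * expR 0.
    apply: cvgMr; apply: continuous_cvg; first exact: continuous_expR.
    by rewrite -[X in _ --> X](mul0r (x 0 i)); apply: cvgMl; exact: cvg_inv_nat.
  by rewrite expR0 mulr1 in h.
Unshelve. all: by end_near. Qed.

Lemma log_law_cvg (e : R) : 0 < e ->
  \forall n \near \oo, tvle (log_law (Cn n)) (log_law CG) e.
Proof.
(* Four comparisons, each costing three times the chosen accuracy. *)
move=> e0; have e1 : 0 < e / 12 by rewrite divr_gt0.
have [M _ hM] := root_copula_law_cvg e1.
(* The successor makes [k] positive. *)
pose k := M.+1.
have hk : tvle (log_law CG) (root_copula_law k) (3 * (e / 12)) by apply: hM; exact: leqW.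
near=> n.
have n0 : (0 < n)%N by near: n; exact: nbhs_infty_gt.
have hn : tvle (log_law CG) (root_copula_law n) (3 * (e / 12)).
  by apply: hM; near: n; exact: nbhs_infty_ge.
have hkn : tvle (root_copula_law k) (pow_law n (root_copula_law k)) (3 * (e / 12)).
  by near: n; exact: root_copula_law_rescale.
(* mu_k and mu_n are compared through the limit law, at the cost of two of the four errors, before
   both are transported by [S_n]. *)
have h1 := tvle_trans (tvle_sym hk) hn.
have h2 : tvle (pow_law n (root_copula_law k)) (pow_law n (root_copula_law n)) _ :=
  tvle_push _ h1.
have h3 := tvle_sym (tvle_trans (tvle_trans hk hkn) h2).
rewrite (_ : e = 3 * (e / 12) + 3 * (e / 12) + (3 * (e / 12) + 3 * (e / 12))); last by lra.
by move=> A mA; have := h3 A mA; rewrite root_lawK.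
Unshelve. all: by end_near. Qed.

(** Both laws are carried by [unit_box], on which the logarithm is inverted by the exponential, so
    each Borel set is measured exactly by its preimage under the exponential. *)
Lemma total_variation_cvg (e : R) : 0 < e -> \forall n \near \oo,
  forall A : set brV, measurable A -> (`|Cn n A - CG A| <= e%:E)%E.
Proof.
move=> e0; near=> n => A mA.
have n0 : (0 < n)%N by near: n; exact: nbhs_infty_gt.
rewrite (log_lawK (Cn_unit_box n0) mA) (log_lawK CG_unit_box mA).
apply: tvle_dist; last by near: n; exact: log_law_cvg.
by apply: preimage_measurable => //; exact: measurable_cmap_expR.
Unshelve. all: by end_near. Qed.

End extreme_value.

Unset Implicit Arguments.
Set Strict Implicit.
Set Printing Implicit Defensive.

Theorem corollary2p7 (R : realType) (d : nat) (hd : (2 <= d)%N)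
  (D : 'rV[R]_d -> R) (hD : is_Dnorm D)
  (hD_partials : has_partials d neg_orthant D)
  (C : 'rV[R]_d -> R) (hC : is_copula C)
  (hC_partials : has_continuous_partials d open_cube C)
  (N : 'rV[R]_d -> R) (hN : is_norm N)
  (h_i : forall eps : R, 0 < eps ->
     \forall u \near within closed_cube (nbhs (const_mx 1 : 'rV[R]_d)),
       `|C u - (1 - D (const_mx 1 - u))| <= eps * N (const_mx 1 - u))
  (h_ii : forall s : seq 'I_d, s <> [::] -> uniq s ->
     forall x : 'rV[R]_d, neg_orthant x ->
       (fun n : nat =>
          partial s (fun y => n%:R * (C (const_mx 1 + n%:R^-1 *: y) - 1)) x)
         @ \oo --> partial s (fun y => - D y) x)
  (* the probability measures with distribution functions C^(n) and C_G *)
  (Cn : nat -> probability (borel_rV R d) R)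
  (hCn : forall n : nat, (0 < n)%N ->
     forall u, closed_cube u -> df (Cn n) u = copula_power C n u)
  (CG : probability (borel_rV R d) R)
  (hCG : forall u, closed_cube u -> df CG u = evc D u) :
  (fun n : nat =>
     ereal_sup [set (`|Cn n A - CG A|)%E |
                A in [set A : set (borel_rV R d) |
                      measurable A /\ A `<=` closed_cube]])
    @ \oo --> (0%E : \bar R).
Proof.
have TV (e : R) : 0 < e -> \forall n \near \oo, forall A : set (borel_rV R d),
    measurable A -> (`|Cn n A - CG A| <= e%:E)%E.
  exact: (total_variation_cvg (proj1 hD) hD_partials hC hC_partials hN h_i h_ii hCn hCG).
set S := (X in X @ \oo --> _).
have S0 n : (0 <= S n)%E.
  apply: ereal_sup_ubound; exists set0; first by split.
  by rewrite !measure0 subee// abse0.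
have Se (e : R) : 0 < e -> \forall n \near \oo, (S n <= e%:E)%E.
  move=> e0; apply: filterS (TV e e0) => n h.
  by apply: ge_ereal_sup => _ [A [mA _] <-]; exact: h.
have Sfin n (e : R) : (S n <= e%:E)%E -> S n \is a fin_num.
  by move=> h; rewrite ge0_fin_numE// (le_lt_trans h)// ltry.
apply/fine_cvgP; split.
  by apply: filterS (Se 1 ltr01) => n; exact: Sfin.
apply/cvgrPdist_le => e e0; apply: filterS (Se e e0) => n h.
by rewrite sub0r normrN ger0_norm ?fine_ge0//= -lee_fin fineK ?(Sfin n e).
Qed.
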